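(* Let $n\ge 3$ and let $\beta=(\beta_1,\ldots,\beta_n)$ be a multi-index of real numbers with $\beta_k>-1/2$ for $1\le k\le n$. Then $$\int_{\partial B(0,1)}x^{2\beta}\,d\sigma(x)=\frac{2}{\Gamma(|\beta|+n/2)}\prod_{k=1}^n\Gamma(\beta_k+1/2).$$ In particular, when $\beta=\alpha$ is a multi-index of nonnegative integers, $$\frac1{\omega_n}\int_{\partial B(0,1)}x^{2\alpha}\,d\sigma(x)=\frac{\prod_{1\le k\le n,\ \alpha_k\ne 0}(2\alpha_k-1)!!}{(n+2|\alpha|-2)\cdots(n+2)\,n}.$$ Furthermore, for every $1\le m\le n$, as $\beta_1,\ldots,\beta_m\to\infty$ (with $\beta_{m+1},\ldots,\beta_n$ fixed), $$\int_{\partial B(0,1)}x^{2\beta}\,d\sigma(x)\sim 2\,(2\pi)^{(m-1)/2}\,e^{(\beta_{m+1}+\cdots+\beta_n)}\prod_{k=m+1}^n\Gamma(\beta_k+1/2)\;\frac{\prod_{k=1}^m\beta_k^{\beta_k}}{|\beta|^{|\beta|+(n-1)/2}}.$$ And if all the $\beta_j\to\infty$, then $$\int_{\partial B(0,1)}x^{2\beta}\,d\sigma(x)\sim 2\,(2\pi)^{(n-1)/2}\,\frac{\prod_{k=1}^n\beta_k^{\beta_k}}{|\beta|^{|\beta|+(n-1)/2}}.$$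
   Context: $B(0,1)$ is the unit ball of $\mathbb{R}^n$, $\partial B(0,1)$ the unit sphere, $d\sigma$ the surface area element on the unit sphere, and $\omega_n=2\pi^{n/2}/\Gamma(n/2)$ its total surface area; $\Gamma(s)=\int_0^\infty e^{-t}t^{s-1}\,dt$ for $s>0$. For a multi-index $\beta$ of real numbers, $|\beta|=\beta_1+\cdots+\beta_n$ (the plain sum, without absolute values) and $x^{2\beta}=|x_1|^{2\beta_1}\cdots|x_n|^{2\beta_n}$. For an odd positive integer $k$, $k!!=k(k-2)\cdots 1$. The denominator $(n+2|\alpha|-2)\cdots(n+2)n$ is $\prod_{j=0}^{|\alpha|-1}(n+2j)$, and empty products equal $1$. The notation $F\sim G$ means that the ratio $F/G$ tends to $1$ in the indicated limit. *)

(* Defs.v *)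
From HB Require Import structures.
From mathcomp Require Import all_boot all_order all_algebra.
From mathcomp Require Import all_classical all_reals all_analysis.
Set Implicit Arguments.
Unset Strict Implicit.
Unset Printing Implicit Defensive.
Import Order.TTheory GRing.Theory Num.Theory.
Import numFieldNormedType.Exports.
Local Open Scope classical_set_scope.
Local Open Scope ring_scope.

Section cons_measure.
Context {R : realType} {dT : measure_display} {T : measurableType dT} (d : nat).

Definition cons_pair (z : T * d.-tuple T) : d.+1.-tuple T :=
  [tuple of z.1 :: z.2].

Lemma measurable_cons_pair : measurable_fun setT cons_pair.
Proof. exact: measurable_cons measurable_fst measurable_snd. Qed.

Variable mu : {sigma_finite_measure set T -> \bar R}.
Variable m : {sigma_finite_measure set (d.-tuple T) -> \bar R}.

Definition cons_measure : set (d.+1.-tuple T) -> \bar R :=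
  pushforward (mu \x m)%E cons_pair.

Let cons_measure0 : cons_measure set0 = 0%E.
Proof. by rewrite /cons_measure /pushforward preimage_set0 measure0. Qed.

Let cons_measure_ge0 A : (0 <= cons_measure A)%E.
Proof. by rewrite /cons_measure /pushforward; exact: measure_ge0. Qed.

Let measurable_preimage_cons A :
  measurable A -> measurable (cons_pair @^-1` A).
Proof.
by move=> mA; rewrite -[X in measurable X]setTI; exact: measurable_cons_pair.
Qed.

Let cons_measure_sigma_additive : semi_sigma_additive cons_measure.
Proof.
move=> F mF tF mUF; rewrite /cons_measure /pushforward preimage_bigcup.
apply: measure_semi_sigma_additive.
- by move=> n; exact: measurable_preimage_cons.
- apply/trivIsetP => /= i j _ _ ij; rewrite -preimage_setI.
  by move/trivIsetP : tF => /(_ _ _ _ _ ij) ->//; rewrite preimage_set0.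
- by rewrite -preimage_bigcup; exact: measurable_preimage_cons.
Qed.

HB.instance Definition _ := isMeasure.Build _ _ _ cons_measure
  cons_measure0 cons_measure_ge0 cons_measure_sigma_additive.

Let cons_measure_sigma_finite : sigma_finite setT cons_measure.
Proof.
have /sigma_finiteP[F [TF ndF Foo]] := sigma_finiteT mu.
have /sigma_finiteP[G [TG ndG Goo]] := sigma_finiteT m.
exists (fun i => [set t | F i (thead t) /\ G i [tuple of behead t]]).
  apply/esym; rewrite -subTset => t _.
  have [i _ Fi] : (\bigcup_i F i) (thead t) by rewrite -TF.
  have [j _ Gj] : (\bigcup_i G i) [tuple of behead t] by rewrite -TG.
  exists (maxn i j) => //; split.
  - by move: Fi; exact/subsetPset/ndF/leq_maxl.
  - by move: Gj; exact/subsetPset/ndG/leq_maxr.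
move=> i; have [mFi Fi] := Foo i; have [mGi Gi] := Goo i; split.
  rewrite [X in measurable X](_ : _ =
      ((@thead d T) @^-1` F i) `&`
      ((fun t : d.+1.-tuple T => [tuple of behead t]) @^-1` G i))//.
  apply: measurableI; rewrite -[X in measurable X]setTI.
  - exact: (@measurable_tnth _ _ _ ord0).
  - exact: measurable_behead.
rewrite /cons_measure /pushforward.
rewrite [X in (_ \x _)%E X](_ : _ = F i `*` G i).
  by rewrite product_measure1E// lte_mul_pinfty// ge0_fin_numE.
apply/seteqP; split=> -[x y] /=; rewrite theadE.
  by move=> [? Gy]; split => //; congr (G i _): Gy; exact: val_inj.
by move=> [? Gy]; split => //; congr (G i _): Gy; exact: val_inj.
Qed.

HB.instance Definition _ := Measure_isSigmaFinite.Build _ _ _ cons_measure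
  cons_measure_sigma_finite.

End cons_measure.

(* Lebesgue measure on R^d, as the d-fold product of Lebesgue measures on R. *)
Fixpoint lebesgue_tuple (R : realType) (d : nat) :
    {sigma_finite_measure set (d.-tuple (measurableTypeR R)) -> \bar R} :=
  match d with
  | 0 => \d_[tuple]
  | d'.+1 => cons_measure (@lebesgue_measure R) (lebesgue_tuple R d')
  end.

(* `lin1_mx` acts on row vectors, so the rows of 'J phi y are the partial
   derivatives of phi and the product below is their Gram matrix. *)
Definition area_element (R : realType) (d n : nat)
    (phi : 'rV[R]_d -> 'rV[R]_n) (y : 'rV[R]_d) : R :=
  Num.sqrt (\det ('J phi y *m ('J phi y)^T)).

Definition surface_integral (R : realType) (d n : nat)
    (phi : 'rV[R]_d -> 'rV[R]_n) (D : set 'rV[R]_d)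
    (f : 'rV[R]_n -> \bar R) : \bar R :=
  (\int[lebesgue_tuple R d]_(t in [set t | D (\row_i tnth t i)])
     (f (phi (\row_i tnth t i)) * (area_element phi (\row_i tnth t i))%:E))%E.

Definition sqnorm (R : realType) (n : nat) (x : 'rV[R]_n) : R :=
  \sum_(i < n) x 0 i ^+ 2.

Definition open_unit_ball (R : realType) (n : nat) : set 'rV[R]_n :=
  [set x | sqnorm x < 1].

(* (y_1, ..., y_(n-1)) |-> (y_1, ..., y_(n-1), s * sqrt (1 - |y|^2)); with
   s = 1 and s = -1 this parametrizes the two open hemispheres of the unit
   sphere of R^n. *)
Definition hemisphere (R : realType) (n : nat) (s : R) (y : 'rV[R]_n.-1) :
    'rV[R]_n :=
  \row_(k < n) if insub (k : nat) is Some j then y 0 j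
               else s * Num.sqrt (1 - sqnorm y).

(* The equator x_n = 0, which the two charts omit, has surface measure 0. *)
Definition sphere_integral (R : realType) (n : nat) (f : 'rV[R]_n -> \bar R) :
    \bar R :=
  (surface_integral (hemisphere 1) (@open_unit_ball R n.-1) f +
   surface_integral (hemisphere (-1)) (@open_unit_ball R n.-1) f)%E.

Definition Gamma (R : realType) (s : R) : R :=
  \int[@lebesgue_measure R]_(t in `]0, +oo[) (expR (- t) * t `^ (s - 1)).

Definition omega (R : realType) (n : nat) : R :=
  2 * pi `^ (n%:R / 2) / Gamma (n%:R / 2).

Definition mabs (R : realType) (n : nat) (b : 'I_n -> R) : R :=
  \sum_(k < n) b k.

(* x^(2 b).  Where a coordinate with b_k < 0 vanishes the value is 0 rather
   than +oo, by the convention of `^; this is a set of surface measure 0. *)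
Definition even_monomial (R : realType) (n : nat) (b : 'I_n -> R)
    (x : 'rV[R]_n) : R :=
  \prod_(k < n) `|x 0 k| `^ (2 * b k).

Definition monomial_integral (R : realType) (n : nat) (b : 'I_n -> R) : \bar R :=
  sphere_integral (fun x => (even_monomial b x)%:E).

Fixpoint double_fact (k : nat) : nat :=
  if k is k'.+2 then (k * double_fact k')%N else 1%N.

(* The filter of neighbourhoods of infinity in the first m coordinates jointly,
   the other coordinates being kept equal to those of c. *)
Definition first_to_infty (R : realType) (n m : nat) (c : 'I_n -> R) :
    set_system ('I_n -> R) :=
  filter_from setT (fun M : R => [set b |
    (forall k : 'I_n, (k < m)%N -> M < b k) /\
    (forall k : 'I_n, (m <= k)%N -> b k = c k)]).

Definition all_to_infty (R : realType) (n : nat) : set_system ('I_n -> R) :=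
  filter_from setT (fun M : R => [set b | forall k : 'I_n, M < b k]).

(* f ~ g along F: the ratio tends to 1. *)
Definition asymp (R : realType) (T : Type) (F : set_system T) (f g : T -> R) :=
  (fun x => f x / g x) @ F --> (1 : R).

(* Main.v *)
(* In the two charts the surface element is (1 - |y|^2)^(-1/2) dy, so the sphere
   integral is twice that of prod |y_i|^(2 b_i) (1 - |y|^2)^(b_n - 1/2) over the
   unit ball of R^(n-1).  Integrating out one coordinate at a time, the integral
   over the ball of squared radius r stays a constant times a power of r, and
   the constants are one-dimensional Beta integrals.  Scaling gives
   their homogeneity in r, and a Laplace transform in r (Tonelli) turns each of
   them into a product of two Gamma integrals.
   The asymptotics reduce to Stirling's formula for real arguments: with
   y = sqrt x + u in Gamma(x + 1/2) = 2 int_0^oo y^(2x) e^(-y^2) dy, the integrand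
   divided by x^x e^(-x) is dominated by e^(-u^2) and tends to e^(-2u^2). *)
Require Import Defs.
From mathcomp Require Import all_boot all_order all_algebra.
From mathcomp Require Import all_classical all_reals all_analysis.
From mathcomp Require Import measurable_realfun ring lra.
Set Implicit Arguments.
Unset Strict Implicit.
Unset Printing Implicit Defensive.
Import Order.TTheory GRing.Theory Num.Theory.
Import numFieldNormedType.Exports.
Local Open Scope classical_set_scope.
Local Open Scope ring_scope.

(** * Changes of variables on the line *)

(** The Gamma and Beta integrals are handled in the extended reals, because the identity linking
    them is needed before either is known to be finite. At c = 1 that identity is the functional
    equation of Gamma, obtained without integration by parts. The Gaussian bound behind Stirling's
    formula gives finiteness only for s > 1/2; the functional equation then carries it to all s > 0.
    One estimate thus serves both convergence of the integral and its asymptotics. Truncated powers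
    encode the domains: every integral over a ball becomes an integral over the whole space, so
    Tonelli, translations and scalings never have to track a region that depends on the other
    variables. *)

Lemma ge0_integral_shift (R : realType) (f : R -> \bar R) (a : R) :
  measurable_fun [set: R] f -> (forall x, 0 <= f x)%E ->
  (\int[@lebesgue_measure R]_x f (x + a)%R = \int[@lebesgue_measure R]_x f x)%E.
Proof.
move=> mf f0.
have mphi : measurable_fun setT (fun x : measurableTypeR R => x + a : measurableTypeR R).
  exact: measurable_funD.
rewrite -[LHS](@ge0_integral_pushforward _ _ _ _ _ _ mphi (@lebesgue_measure R) setT f)//.
(* By uniqueness of Lebesgue measure, the pushforward by the translation need only be compared with
   it on half-open intervals. *)
apply: eq_measure_integral => A mA _; apply/esym/lebesgue_measure_unique => // _ [[l u]] _ <-.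
rewrite /pushforward/= [X in _ = lebesgue_measure X](_ : _ = `](l - a), (u - a)]%classic).
  by rewrite !lebesgue_measure_itv/= !lte_fin ltrD2r -!EFinB opprB addrA subrK.
by apply/seteqP; split => x /=; rewrite !in_itv/= ltrBlDr lerBrDr.
Qed.

Lemma ge0_integral_scale (R : realType) (f : R -> \bar R) (k : R) : 0 < k ->
  measurable_fun [set: R] f -> (forall x, 0 <= f x)%E ->
  (\int[@lebesgue_measure R]_x f (k * x)%R =
   (k^-1)%:E * \int[@lebesgue_measure R]_x f x)%E.
Proof.
move=> k0 mf f0.
have mphi : measurable_fun setT (fun x : measurableTypeR R => k * x : measurableTypeR R).
  exact: measurable_funM.
rewrite -[LHS](@ge0_integral_pushforward _ _ _ _ _ _ mphi (@lebesgue_measure R) setT f)//.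
have k'0 : 0 <= k by exact: ltW.
have ki0 : 0 <= k^-1 by rewrite invr_ge0.
apply/esym; rewrite -[LHS](ge0_integral_mscale (@lebesgue_measure R) measurableT (NngNum ki0))//.
apply: eq_measure_integral => A mA _.
(* The pushforward by y = k x shrinks lengths by k, so it is k times the pushforward that agrees
   with Lebesgue measure on intervals. *)
suff H : forall A, measurable A -> lebesgue_measure A = mscale (NngNum k'0)
    (pushforward lebesgue_measure (fun x : measurableTypeR R => k * x : measurableTypeR R)) A.
  rewrite /= /mscale/= [X in (_ * X)%E](H mphi A mA) /mscale/= muleA -EFinM mulVf ?gt_eqF//.
  by rewrite mul1e.
move=> m; apply: lebesgue_measure_unique => // _ [[l u]] _ <-.
rewrite /= /mscale /pushforward/=
  [X in _ = (_ * lebesgue_measure X)%E](_ : _ = `](l / k), (u / k)]%classic).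
  rewrite !lebesgue_measure_itv/= !lte_fin ltr_pM2r ?invr_gt0//.
  case: ifP => _; last by rewrite mule0.
  by rewrite -!EFinB -EFinM mulrBr !(mulrC k) !divfK ?gt_eqF.
by apply/seteqP; split => x /=; rewrite !in_itv/= ltr_pdivrMr// ler_pdivlMr// mulrC.
Qed.

Lemma ge0_integral_even (R : realType) (f : R -> R) :
  measurable_fun [set: R] f -> (forall x, 0 <= f x) -> (forall x, f (- x) = f x) ->
  (\int[@lebesgue_measure R]_x (f x)%:E =
   2%:E * \int[@lebesgue_measure R]_(x in `]0%R, +oo[) (f x)%:E)%E.
Proof.
move=> mf f0 fN.
have mfE (D : set R) : measurable D ->
    measurable_fun D (fun x : R => (f x)%:E).
  by move=> mD; apply/measurable_EFinP; exact: measurable_funS mf.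
rewrite -(setUv `]-oo, 0%R]%classic) setCitvl/= ge0_integral_setU//=; last 3 first.
- by apply: mfE; apply: measurableU.
- by move=> x _; rewrite lee_fin.
- by rewrite -setCitvl; exact/disj_setPCl.
- rewrite mule_natl mule2n; congr (_ + _)%E.
  under eq_integral do rewrite -fN.
  rewrite -(ge0_integration_by_substitution0 (f := fun x => (f x)%:E))//.
  + by rewrite integral_itv_obnd_cbnd//; exact: mfE.
  + exact: mfE.
Qed.

(** Substitution and continuity are available on compact intervals only. The sets [1/u, u] stay away
    from a possible singularity at 0, and monotone convergence recovers the half-line. *)
Lemma integral_pos_exhaust (R : realType) (f : R -> R) (u : R^nat) :
  measurable_fun [set: R] f -> (forall x, 0 <= f x) ->
  nondecreasing_seq u -> (forall n, 0 < u n) -> u n @[n --> \oo] --> +oo ->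
  (\int[@lebesgue_measure R]_(x in `[((u n)^-1)%R, u n]) (f x)%:E)%E @[n --> \oo] -->
  (\int[@lebesgue_measure R]_(x in `]0%R, +oo[) (f x)%:E)%E.
Proof.
move=> mf f0 ndu u0 uoo.
have -> : `]0%R, +oo[%classic = \bigcup_n `[(u n)^-1, u n]%classic.
  apply/seteqP; split => [x|x [n _]] /=; rewrite !in_itv/=.
    rewrite andbT => x0.
    have /cvgryPge/(_ (Num.max x x^-1))[N _ /(_ _ (leqnn N))/=] := uoo.
    rewrite ge_max => /andP[xN xVN]; exists N => //=.
    by rewrite in_itv/= xN andbT -[x]invrK lef_pV2// posrE// invr_gt0.
  by rewrite andbT => /andP[+ _]; apply: lt_le_trans; rewrite invr_gt0.
apply: ge0_nondecreasing_set_cvg_integral => //.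
- apply/nondecreasing_seqP => n; rewrite subsetEset => x /=.
  rewrite !in_itv/= => /andP[unx xun].
  rewrite (le_trans _ unx) ?(le_trans xun)//; first exact: ndu.
  by rewrite lef_pV2 ?posrE//; exact: ndu.
- by move=> n; exact/measurable_EFinP/measurable_funTS.
- by move=> n x _; rewrite lee_fin.
Qed.

(* Substitution x = y^2, through [1/n^2, n^2] = { y^2 | y in [1/n, n] }. *)
Lemma ge0_integral_pos_sqr (R : realType) (g : R -> R) :
  measurable_fun [set: R] g -> (forall x, 0 <= g x) ->
  (forall x, 0 < x -> {for x, continuous g}) ->
  (\int[@lebesgue_measure R]_(x in `]0%R, +oo[) (g x)%:E =
   \int[@lebesgue_measure R]_(y in `]0%R, +oo[) (g (y ^+ 2) * (2 * `|y|))%:E)%E.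
Proof.
move=> mg g0 cg.
have ndn : nondecreasing_seq (fun n : nat => n.+1%:R : R).
  by move=> m n mn; rewrite ler_nat ltnS.
have H1 : (\int[@lebesgue_measure R]_(x in `[((n.+1%:R ^+ 2)^-1)%R, (n.+1%:R ^+ 2)%R])
    (g x)%:E)%E @[n --> \oo] -->
  (\int[@lebesgue_measure R]_(x in `]0%R, +oo[) (g x)%:E)%E.
  apply: (@integral_pos_exhaust _ g (fun n : nat => (n.+1%:R : R) ^+ 2)) => //.
    by move=> m n mn; rewrite lerXn2r ?nnegrE// ndn.
  apply/cvgryPge => A; near=> n.
  rewrite (@le_trans _ _ n.+1%:R)//; last by rewrite expr2 ler_peMl// ler1n.
  near: n; have /cvgryPge := @cvgr_idn R; move=> /(_ A)[N _ H]; exists N => // n /= Nn.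
  by rewrite (le_trans (H n Nn))// ler_nat.
(* Writing [|y|] instead of y keeps the integrand nonnegative on all of R, as [integral_pos_exhaust]
   requires. *)
have H2 : (\int[@lebesgue_measure R]_(y in `[(n.+1%:R^-1)%R, n.+1%:R%R])
    (g (y ^+ 2) * (2 * `|y|))%:E)%E @[n --> \oo] -->
  (\int[@lebesgue_measure R]_(y in `]0%R, +oo[) (g (y ^+ 2) * (2 * `|y|))%:E)%E.
  apply: (@integral_pos_exhaust _ (fun y => g (y ^+ 2) * (2 * `|y|))
    (fun n : nat => n.+1%:R)) => //.
  - apply: measurable_funM.
      by apply: measurableT_comp => //; exact: measurable_funX.
    by apply: measurable_funM => //; exact: measurableT_comp.
  - by move=> x; rewrite mulr_ge0// mulr_ge0.
  - apply/cvgryPge => A.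
    have /cvgryPge := @cvgr_idn R; move=> /(_ A)[N _ H]; exists N => // n /= Nn.
    by rewrite (le_trans (H n Nn))// ler_nat.
rewrite -(cvg_lim _ H1)// -(cvg_lim _ H2)//; congr (limn _); apply/funext => n.
have n0 : 0 < (n.+1%:R : R)^-1 by rewrite invr_gt0.
have dsqr (x : R) : is_derive x 1 (fun y : R => y ^+ 2) (2 * x).
  have -> : (fun y : R => y ^+ 2) = (idfun : R -> R) ^+ 2.
    by apply/funext => y; rewrite expr2.
  have := @is_deriveX _ _ idfun 2 x 1 1 (is_derive_id x 1).
  by rewrite /GRing.scale/= expr1 mulr1.
have dE : derive1 (fun y : R => y ^+ 2) = (fun y => 2 * y).
  by apply/funext => x; rewrite derive1E derive_val.
have csqr : continuous (fun y : R => y ^+ 2) by move=> x; exact: exprn_continuous.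
have c2 : continuous (fun y : R => 2 * y).
  by move=> x; apply: cvgM; [exact: cvg_cst|exact: cvg_id].
rewrite -exprVn (@integration_by_substitution_increasing _ (fun y : R => y ^+ 2)).
- apply: eq_integral => y; rewrite inE/= in_itv/= => /andP[ny _].
  by rewrite dE ger0_norm// (le_trans _ ny)// ltW.
- by rewrite (@le_trans _ _ 1)// ?ler1n// invf_le1// ler1n.
- move=> x y; rewrite !in_itv/= => /andP[nx _] _ xy.
  by rewrite ltrXn2r// ltW// (lt_le_trans n0).
- by move=> x _; rewrite dE.
- by rewrite dE; apply/cvg_ex; eexists; apply: cvg_at_right_filter; exact: c2.
- by rewrite dE; apply/cvg_ex; eexists; apply: cvg_at_left_filter; exact: c2.
- split; first by move=> x _; exact: ex_derive.
  + by apply: cvg_at_right_filter; exact: csqr.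
  + by apply: cvg_at_left_filter; exact: csqr.
- apply/continuous_in_subspaceT => x; rewrite inE/= in_itv/= => /andP[nx _].
  by apply: cg; apply: lt_le_trans nx; rewrite exprn_gt0.
Unshelve. all: by end_near. Qed.

Lemma ge0_integral_lebesgueZl (R : realType) (k : \bar R) (f : R -> R) : (0 <= k)%E ->
  measurable_fun [set: R] f -> (forall x, 0 <= f x) ->
  (\int[@lebesgue_measure R]_x (k * (f x)%:E) = k * \int[@lebesgue_measure R]_x (f x)%:E)%E.
Proof.
move=> k0 mf f0; rewrite ge0_integralZl//; first exact/measurable_EFinP.
by move=> x _; rewrite lee_fin.
Qed.

(** * Gamma and Beta integrals *)

(* The truncated power t_+^a. *)
Definition powpos (R : realType) (a t : R) : R := if 0 < t then t `^ a else 0.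

Lemma powpos_ge0 (R : realType) (a t : R) : 0 <= powpos a t.
Proof. by rewrite /powpos; case: ifP => // _; exact: powR_ge0. Qed.

Lemma powpos_gt0E (R : realType) (a t : R) : 0 < t -> powpos a t = t `^ a.
Proof. by rewrite /powpos => ->. Qed.

Lemma measurable_powpos (R : realType) (a : R) : measurable_fun [set: R] (powpos a).
Proof.
apply: measurable_fun_ifT => //=; first exact: measurable_fun_ltr.
Qed.

Lemma measurable_normpow (R : realType) (a : R) :
  measurable_fun [set: R] (fun y : R => `|y| `^ a).
Proof. by apply: (measurableT_comp (measurable_powR a)); exact: normr_measurable. Qed.

Lemma measurable_expRN (R : realType) : measurable_fun [set: R] (fun y : R => expR (- y)).
Proof. exact: measurableT_comp. Qed.

(* Extended-real valued, so that Tonelli applies before finiteness is known. *)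
Definition EGamma (R : realType) (s : R) : \bar R :=
  (\int[@lebesgue_measure R]_t (powpos (s - 1) t * expR (- t))%:E)%E.

Lemma measurable_EGamma_integrand (R : realType) (s : R) :
  measurable_fun [set: R] (fun t => powpos s t * expR (- t)).
Proof.
by apply: measurable_funM; [exact: measurable_powpos|exact: measurable_expRN].
Qed.

Lemma EGamma_integrand_ge0 (R : realType) (s t : R) : 0 <= powpos s t * expR (- t).
Proof. by rewrite mulr_ge0 ?expR_ge0// powpos_ge0. Qed.

Lemma EGamma_ge0 (R : realType) (s : R) : (0 <= EGamma s)%E.
Proof.
by apply: integral_ge0 => t _; rewrite lee_fin mulr_ge0 ?expR_ge0// powpos_ge0.
Qed.

Lemma EGamma_itv (R : realType) (s : R) : EGamma s =
  (\int[@lebesgue_measure R]_(t in `]0%R, +oo[) (expR (- t) * t `^ (s - 1))%:E)%E.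
Proof.
rewrite /EGamma [RHS]integral_mkcond; apply: eq_integral => t _.
rewrite patchE; case: ifPn => [|/negP].
  by rewrite inE/= in_itv/= andbT => t0; rewrite powpos_gt0E// mulrC.
by rewrite inE/= in_itv/= andbT /powpos => /negP/negbTE ->; rewrite mul0r.
Qed.

Lemma GammaE (R : realType) (s : R) : Gamma s = fine (EGamma s).
Proof. by rewrite EGamma_itv. Qed.

Lemma EGamma_gauss_itv (R : realType) (b : R) : (EGamma (b + 1 / 2) =
  2%:E * \int[@lebesgue_measure R]_(y in `]0%R, +oo[) (y `^ (2 * b) * expR (- y ^+ 2))%:E)%E.
Proof.
pose g (x : R) := powpos (b + 1 / 2 - 1) x * expR (- x).
have -> : EGamma (b + 1 / 2) =
    (\int[@lebesgue_measure R]_(x in `]0%R, +oo[) (g x)%:E)%E.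
  rewrite EGamma_itv; apply: eq_integral => t.
  by rewrite inE/= in_itv/= andbT => t0; rewrite /g powpos_gt0E// mulrC.
rewrite ge0_integral_pos_sqr.
- rewrite -ge0_integralZl//; last 2 first.
  + apply/measurable_EFinP/measurable_funTS; apply: measurable_funM.
      exact: measurable_powR.
    by apply: measurableT_comp => //; apply: measurableT_comp => //.
  + by move=> y _; rewrite lee_fin mulr_ge0 ?expR_ge0// powR_ge0.
  apply: eq_integral => y; rewrite inE/= in_itv/= andbT => y0.
  rewrite /g powpos_gt0E ?exprn_gt0// gtr0_norm// -EFinM; congr EFin.
  (* The power y^(2b) is (y^2)^(b - 1/2) times the factor y of dx = 2 y dy. *)
  have -> : 2 * b = 2 * (b + 1 / 2 - 1) + 1 by lra.
  rewrite [in RHS]powRD; last by rewrite (gt_eqF y0) implybT.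
  rewrite powRr1 ?ltW// powRrM powR_mulrn ?ltW//.
  by ring.
- exact: measurable_EGamma_integrand.
- by move=> x; rewrite mulr_ge0 ?expR_ge0// powpos_ge0.
- move=> x x0; apply: differentiable_continuous; apply/derivable1_diffP.
  apply: (@near_eq_derivable _ _ _ (fun x => x `^ (b + 1 / 2 - 1) * expR (- x))) => //.
    near=> z; rewrite /g powpos_gt0E//; near: z; exact: lt_nbhsr.
  apply: derivableM; first by apply: derivable_powR; rewrite in_itv/= andbT.
  apply: diff_derivable; apply: differentiable_comp; last exact/derivable1_diffP.
  exact/derivable1_diffP.
Unshelve. all: by end_near. Qed.

Lemma measurable_gauss_integrand (R : realType) (a : R) :
  measurable_fun [set: R] (fun y : R => `|y| `^ a * expR (- y ^+ 2)).
Proof.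
apply: measurable_funM; first exact: measurable_normpow.
by apply: measurableT_comp => //; exact: measurableT_comp.
Qed.

Lemma gauss_integrand_ge0 (R : realType) (a y : R) : 0 <= `|y| `^ a * expR (- y ^+ 2).
Proof. by rewrite mulr_ge0 ?powR_ge0// expR_ge0. Qed.

Lemma EGamma_gauss (R : realType) (b : R) : (EGamma (b + 1 / 2) =
  \int[@lebesgue_measure R]_y (`|y| `^ (2 * b) * expR (- y ^+ 2))%:E)%E.
Proof.
have -> : (\int[@lebesgue_measure R]_y (`|y| `^ (2 * b) * expR (- y ^+ 2))%:E =
  2%:E * \int[@lebesgue_measure R]_(y in `]0%R, +oo[) (`|y| `^ (2 * b) * expR (- y ^+ 2))%:E)%E.
  apply: ge0_integral_even.
  - exact: measurable_gauss_integrand.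
  - exact: gauss_integrand_ge0.
  - by move=> x; rewrite normrN sqrrN.
rewrite (EGamma_gauss_itv b).
apply: (f_equal (mule 2%:E)).
apply: eq_integral => y.
by rewrite inE/= in_itv/= andbT => y0; rewrite gtr0_norm.
Qed.

(* The Beta function B(b + 1/2, c). *)
Definition EBeta (R : realType) (b c : R) : \bar R :=
  (\int[@lebesgue_measure R]_y (`|y| `^ (2 * b) * powpos (c - 1) (1 - y ^+ 2))%:E)%E.

Lemma EBeta_ge0 (R : realType) (b c : R) : (0 <= EBeta b c)%E.
Proof.
by apply: integral_ge0 => t _; rewrite lee_fin mulr_ge0 ?powR_ge0// powpos_ge0.
Qed.

Lemma measurable_EBeta_integrand (R : realType) (b c r : R) :
  measurable_fun [set: R] (fun y : R => `|y| `^ (2 * b) * powpos (c - 1) (r - y ^+ 2)).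
Proof.
apply: measurable_funM; first exact: measurable_normpow.
apply: measurableT_comp; first exact: measurable_powpos.
by apply: measurable_funB => //; apply: measurable_funX.
Qed.

Lemma EBeta_integrand_ge0 (R : realType) (b c r y : R) :
  0 <= `|y| `^ (2 * b) * powpos (c - 1) (r - y ^+ 2).
Proof. by rewrite mulr_ge0 ?powR_ge0// powpos_ge0. Qed.

(** Put y = sqrt r z: the monomial yields r^b, the truncated power r^(c-1) and dy the remaining
    r^(1/2). For r <= 0 both sides vanish, since r - y^2 is never positive. *)
Lemma EBeta_scale (R : realType) (b c r : R) :
  (\int[@lebesgue_measure R]_y (`|y| `^ (2 * b) * powpos (c - 1) (r - y ^+ 2))%:E =
   (powpos (b + c - 1 / 2) r)%:E * EBeta b c)%E.
Proof.
have [r0|r0] := ltP 0 r; last first.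
  rewrite {2}/powpos ltNge r0/= mul0e.
  apply: integral0_eq => y _.
  rewrite /powpos subr_gt0 ltNge (le_trans r0) ?sqr_ge0//= mulr0//.
set f := fun y : R => (`|y| `^ (2 * b) * powpos (c - 1) (r - y ^+ 2))%:E.
have sr0 : 0 < Num.sqrt r by rewrite sqrtr_gt0.
have mf : measurable_fun [set: R] f.
  by apply/measurable_EFinP; exact: measurable_EBeta_integrand.
have f0 y : (0 <= f y)%E by rewrite lee_fin mulr_ge0 ?powR_ge0// powpos_ge0.
have := ge0_integral_scale sr0 mf f0.
have -> : (\int[@lebesgue_measure R]_y f (Num.sqrt r * y)%R =
   (r `^ (b + c - 1))%:E * EBeta b c)%E.
  rewrite -ge0_integralZl//; last 3 first.
  - by apply/measurable_EFinP; exact: measurable_EBeta_integrand.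
  - by move=> y _; rewrite lee_fin mulr_ge0 ?powR_ge0// powpos_ge0.
  - by rewrite lee_fin powR_ge0.
  apply: eq_integral => y _; rewrite /f -EFinM; congr EFin.
  rewrite normrM powRM// exprMn sqr_sqrtr ?ltW// ger0_norm ?ltW//.
  have -> : Num.sqrt r `^ (2 * b) = r `^ b.
    by rewrite -powR12_sqrt ?ltW// -powRrM; congr (_ `^ _); field.
  rewrite (_ : r - r * y ^+ 2 = r * (1 - y ^+ 2)); last by ring.
  rewrite /powpos pmulr_rgt0//; case: ifPn => [y1|_]; last by rewrite !mulr0.
  rewrite (powRM _ (ltW r0) (ltW y1)) -addrA (@powRD _ r b (c - 1));
    last by rewrite (gt_eqF r0) implybT.
  by ring.
have sr1 : Num.sqrt r * (Num.sqrt r)^-1 = 1 by rewrite mulfV// gt_eqF.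
have -> : powpos (b + c - 1 / 2) r = Num.sqrt r * r `^ (b + c - 1).
  rewrite powpos_gt0E// -powR12_sqrt ?ltW// -powRD; last by rewrite (gt_eqF r0) implybT.
  by congr (_ `^ _); lra.
move: (EBeta b c) (\int[lebesgue_measure]_x f x)%E => B I H.
by rewrite EFinM -muleA H muleA -EFinM sr1 mul1e.
Qed.

(* Take Laplace transforms in r of both sides of EBeta_scale. *)
Lemma EBeta_EGamma (R : realType) (b c : R) :
  (EBeta b c * EGamma (b + c + 1 / 2) = EGamma (b + 1 / 2) * EGamma c)%E.
Proof.
pose F (z : R * R) : \bar R :=
  (`|z.2| `^ (2 * b) * powpos (c - 1) (z.1 - z.2 ^+ 2) * expR (- z.1))%:E.
have F0 z : (0 <= F z)%E.
  by rewrite lee_fin mulr_ge0 ?expR_ge0// mulr_ge0 ?powR_ge0// powpos_ge0.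
have mF : measurable_fun [set: R * R] F.
  apply/measurable_EFinP; apply: measurable_funM; last first.
    exact: (measurableT_comp (@measurable_expRN R) measurable_fst).
  apply: measurable_funM.
    exact: (measurableT_comp (@measurable_normpow R (2 * b)) measurable_snd).
  apply: (measurableT_comp (@measurable_powpos R (c - 1))).
  apply: measurable_funB; first exact: measurable_fst.
  by apply: measurable_funX; exact: measurable_snd.
have := @fubini_tonelli _ _ _ _ _ (@lebesgue_measure R) (@lebesgue_measure R) F mF F0.
move=> {mF F0} H.
have HL r : (\int[@lebesgue_measure R]_y F (r, y) =
    EBeta b c * (powpos (b + c + 1 / 2 - 1) r * expR (- r))%:E)%E.
  rewrite /F/=.
  under eq_integral do rewrite EFinM muleC.
  have e0 : (0 <= (expR (- r))%:E)%E by rewrite lee_fin expR_ge0.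
  rewrite (ge0_integral_lebesgueZl e0 (measurable_EBeta_integrand b c r)
    (EBeta_integrand_ge0 b c r)) EBeta_scale.
  have -> : b + c + 1 / 2 - 1 = b + c - 1 / 2 by lra.
  by rewrite muleA -EFinM muleC (mulrC (expR _)).
have HR y : (\int[@lebesgue_measure R]_x F (x, y) =
    EGamma c * (`|y| `^ (2 * b) * expR (- y ^+ 2))%:E)%E.
  rewrite /F/=.
  (* Translating x by y^2 removes y from the truncated power and splits off e^(-y^2), which leaves a
     Gamma integral in x and a Gaussian one in y. *)
  rewrite -(@ge0_integral_shift _ _ (y ^+ 2)); last 2 first.
  - apply/measurable_EFinP; apply: measurable_funM; last exact: measurable_expRN.
    apply: measurable_funM; first exact: measurable_cst.
    apply: (measurableT_comp (@measurable_powpos R (c - 1))).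
    by apply: measurable_funB; [exact: measurable_id|exact: measurable_cst].
  - move=> x; rewrite lee_fin; apply: mulr_ge0; last exact: expR_ge0.
    by apply: mulr_ge0; [exact: powR_ge0|exact: powpos_ge0].
  have e0 : (0 <= (`|y| `^ (2 * b) * expR (- y ^+ 2))%:E)%E.
    by rewrite lee_fin mulr_ge0 ?expR_ge0// powR_ge0.
  rewrite muleC -(ge0_integral_lebesgueZl e0 (measurable_EGamma_integrand (c - 1))
    (EGamma_integrand_ge0 (c - 1))).
  apply: eq_integral => r _; rewrite addrK opprD expRD -EFinM; congr EFin.
  by ring.
move: H.
under eq_integral do rewrite HL.
under [X in _ = X]eq_integral do rewrite HR.
rewrite (ge0_integral_lebesgueZl (EBeta_ge0 b c) (measurable_EGamma_integrand _)
  (EGamma_integrand_ge0 _)).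
rewrite (ge0_integral_lebesgueZl (EGamma_ge0 c) (measurable_gauss_integrand (2 * b))
  (gauss_integrand_ge0 (2 * b))).
rewrite -/(EGamma (b + c + 1 / 2)) -(EGamma_gauss b) => ->.
exact: muleC.
Qed.

(** At s = 1 the integrand is the density of the exponential law of rate 1, of total mass 1. *)
Lemma EGamma1 (R : realType) : EGamma (1 : R) = 1%E.
Proof.
rewrite EGamma_itv -(integral_exponential_pdf (@ltr01 R)) integral_itv_obnd_cbnd; last first.
  apply/measurable_EFinP/measurable_funTS; apply: measurable_funM.
    exact: measurable_expRN.
  exact: measurable_powR.
rewrite [LHS]integral_mkcond; apply: eq_integral => x _.
rewrite /exponential_pdf !patchE; case: ifP => // _.
by rewrite subrr powRr0 mulr1 mul1r mulN1r.
Qed.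

Lemma integral_powR_itv (R : realType) (a : R) : -1 < a ->
  (\int[@lebesgue_measure R]_(y in `]0%R, 1%R]) (y `^ a)%:E = ((a + 1)^-1)%:E)%E.
Proof.
move=> a1; have a10 : 0 < a + 1 by lra.
(* For a < 0 the integrand is singular at 0, hence the cut-off; [n.+2] makes v n < 1 already at n =
   0. *)
pose v (n : nat) : R := n.+2%:R^-1.
have v0 n : 0 < v n by rewrite invr_gt0.
have v1 n : v n < 1 by rewrite invf_lt1// ltr1n.
have H1 : (\int[@lebesgue_measure R]_(y in `[v n, 1%R]) (y `^ a)%:E)%E @[n --> \oo] -->
    (\int[@lebesgue_measure R]_(y in `]0%R, 1%R]) (y `^ a)%:E)%E.
  have -> : `]0%R, 1%R]%classic = \bigcup_n `[v n, 1%R]%classic.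
    apply/seteqP; split => [x|x [n _]] /=; rewrite !in_itv/=; last first.
      by move=> /andP[vx ->]; rewrite (lt_le_trans (v0 n)).
    move=> /andP[x0 x1].
    have /cvgryPge/(_ x^-1)[N _ /(_ _ (leqnn N))/= xN] := @cvgr_idn R.
    exists N => //=; rewrite in_itv/= x1 andbT -[x]invrK lef_pV2// ?posrE ?invr_gt0//.
    by rewrite (le_trans xN)// ler_nat ltnW.
  apply: ge0_nondecreasing_set_cvg_integral => //.
  - apply/nondecreasing_seqP => n; rewrite subsetEset => x /=.
    rewrite !in_itv/= => /andP[vx ->]; rewrite andbT (le_trans _ vx)//.
    by rewrite lef_pV2 ?posrE// ler_nat.
  - by move=> n; apply/measurable_EFinP/measurable_funTS; exact: measurable_powR.
  - by move=> n x _; rewrite lee_fin powR_ge0.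
have d (y : R) : 0 < y -> is_derive y 1 (fun y => (a + 1)^-1 * y `^ (a + 1)) (y `^ a).
  move=> y0.
  have := @is_deriveZ _ _ _ (fun y : R => y `^ (a + 1)) (a + 1)^-1 y 1 _
    (is_derive1_powR (a + 1) y0).
  by rewrite /GRing.scale/= mulrA mulVf ?gt_eqF// mul1r addrK.
have Hn n : (\int[@lebesgue_measure R]_(y in `[v n, 1%R]) (y `^ a)%:E)%E =
    ((a + 1)^-1 - (a + 1)^-1 * v n `^ (a + 1))%:E.
  have cp (b y : R) : 0 < y -> {for y, continuous (fun y : R => y `^ b)}.
    move=> y0; apply: differentiable_continuous; apply/derivable1_diffP.
    by apply: derivable_powR; rewrite in_itv/= andbT.
  have cF (y : R) : 0 < y -> {for y, continuous (fun y : R => (a + 1)^-1 * y `^ (a + 1))}.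
    by move=> y0; apply: cvgM; [exact: cvg_cst|exact: cp].
  rewrite (continuous_FTC2 (F := fun y => (a + 1)^-1 * y `^ (a + 1)))//.
  - by rewrite powR1 mulr1.
  - apply/continuous_in_subspaceT => x; rewrite inE/= in_itv/= => /andP[vx _].
    by apply: cp; exact: lt_le_trans vx.
  - split.
    + move=> x; rewrite in_itv/= => /andP[vx _].
      by have [] := d x (lt_trans (v0 n) vx).
    + by apply: cvg_at_right_filter; exact: cF.
    + by apply: cvg_at_left_filter; exact: cF.
  - move=> x; rewrite in_itv/= => /andP[vx _].
    by rewrite derive1E; have [_] := d x (lt_trans (v0 n) vx).
have H2 : (\int[@lebesgue_measure R]_(y in `[v n, 1%R]) (y `^ a)%:E)%E @[n --> \oo] -->
    ((a + 1)^-1)%:E.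
  under eq_fun do rewrite Hn.
  apply: cvg_EFin; first exact: nearW.
  rewrite -[X in _ --> X]subr0; apply: cvgB; first exact: cvg_cst.
  rewrite -(mulr0 (a + 1)^-1); apply: cvgM; first exact: cvg_cst.
  have /cvg_at_rightP := powR_cvg0 a10; apply; split => //.
  have := @cvg_harmonic R; rewrite -cvg_shiftS.
  exact.
by rewrite -(cvg_lim _ H1)// (cvg_lim _ H2).
Qed.

(** At c = 1 the truncated power is the indicator of |y| < 1, which leaves twice the integral of
    y^(2b) over ]0, 1]. *)
Lemma EBeta1 (R : realType) (b : R) : - (1 / 2) < b -> EBeta b 1 = ((b + 1 / 2)^-1)%:E.
Proof.
move=> b0; rewrite /EBeta ge0_integral_even.
- transitivity (2%:E * \int[@lebesgue_measure R]_(y in `]0%R, 1%R]) (y `^ (2 * b))%:E)%E.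
    congr (_ * _)%E.
    rewrite -integral_itv_bndo_bndc; last first.
      by apply/measurable_EFinP/measurable_funTS; exact: measurable_powR.
    rewrite [LHS]integral_mkcond [RHS]integral_mkcond; apply: eq_integral => y _.
    rewrite !patchE !mem_setE !in_itv/= andbT.
    have [y0|//] := ltP 0 y.
    rewrite gtr0_norm// subrr /powpos subr_gt0 expr_lt1 ?ltW//.
    by case: ifP => _; rewrite ?powRr0 ?mulr1 ?mulr0.
  rewrite integral_powR_itv; last by lra.
  by rewrite -EFinM; congr EFin; field; rewrite ?mulr1n; lra.
- exact: measurable_EBeta_integrand.
- by move=> y; rewrite mulr_ge0 ?powR_ge0// powpos_ge0.
- by move=> y; rewrite normrN sqrrN.
Qed.

(** This is [EBeta_EGamma] at b = s - 1/2, c = 1. Being stated in the extended reals, it can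
    transfer finiteness from s + 1 to s. *)
Lemma EGammaS (R : realType) (s : R) : 0 < s -> EGamma s = ((s^-1)%:E * EGamma (s + 1))%E.
Proof.
move=> s0; have := EBeta_EGamma (s - 1 / 2) 1.
rewrite EBeta1; last by lra.
rewrite EGamma1 mule1 subrK => <-.
by congr (_ * EGamma _)%E; lra.
Qed.

(** * Stirling's formula *)

Lemma ln_taylor2 (R : realType) (v : R) : `|v| <= 1 / 2 ->
  `|ln (1 + v) - v + v ^+ 2 / 2| <= 2 * `|v| ^+ 3.
Proof.
(* With w = 1 + v, phi is ln w - (w - 1) + (w - 1)^2 / 2. Its derivative is (w - 1)^2 / w, at most 2
   v^2 between 1 and 1 + v because w >= 1/2 there; the mean value theorem gives the bound. *)
move=> v12; pose phi (w : R) := ln w - 2 * w + w ^+ 2 / 2 + 3 / 2.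
have -> : ln (1 + v) - v + v ^+ 2 / 2 = phi (1 + v) by rewrite /phi; field.
have phi1 : phi 1 = 0 by rewrite /phi ln1; field.
have dphi (w : R) : 0 < w -> is_derive w 1 phi (w^-1 - 2 + w).
  move=> w0; have dl := is_derive1_ln w0.
  apply: is_derive_eq; rewrite /GRing.scale/=.
  by rewrite !mulr1 !mulr0 add0r addr0 -mulr2n -(mulr_natl w 2) mulKf.
have bound a b : a <= b -> 1 / 2 <= a -> `|a - 1| <= `|v| -> `|b - 1| <= `|v| ->
    `|phi b - phi a| <= 2 * `|v| ^+ 2 * (b - a).
  move=> ab a12 av bv.
  have [||c] := @MVT_segment _ phi (fun w => w^-1 - 2 + w) a b ab.
  - by move=> x; rewrite in_itv/= => /andP[ax _]; apply: dphi; lra.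
  - apply/continuous_in_subspaceT => x; rewrite inE/= in_itv/= => /andP[ax _].
    apply: differentiable_continuous; apply/derivable1_diffP.
    have x0 : 0 < x by lra.
    by have [] := dphi x x0.
  rewrite in_itv/= => /andP[ac cb] ->.
  have c0 : 0 < c by lra.
  have -> : c^-1 - 2 + c = (c - 1) ^+ 2 / c by field; lra.
  rewrite !normrM (ger0_norm (_ : 0 <= b - a)); last lra.
  rewrite ler_wpM2r//; first lra.
  rewrite mulrC; apply: ler_pM => //.
    by rewrite normfV gtr0_norm// -[2]invrK lef_pV2 ?posrE//; lra.
  rewrite -?expr2 ?normrX lerXn2r ?nnegrE//.
  by move: av bv; rewrite !ler_norml => /andP[? ?] /andP[? ?]; apply/andP; split; lra.
have [v0|v0] := leP 0 v.
  have := bound 1 (1 + v); rewrite phi1 subr0 subrr normr0 addrAC subrr add0r lexx.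
  move=> /(_ _ _ _ isT) H; apply: le_trans (H _ _ _) _ => //; try lra.
  rewrite !(ger0_norm v0) le_eqVlt; apply/orP; left; apply/eqP; ring.
have := bound (1 + v) 1; rewrite phi1 sub0r normrN subrr normr0.
rewrite opprD addrA subrr sub0r (addrAC 1) subrr add0r lexx.
move: v12; rewrite ler_norml => /andP[v12 _].
move=> H; apply: le_trans (H _ _ _ _) _ => //; try lra.
rewrite (ltr0_norm v0) le_eqVlt; apply/orP; left; apply/eqP; ring.
Qed.

(** The function y^(2x) e^(-y^2) is largest at y = sqrt x, with value x^x e^(-x). Here it is
    recentred at that point and divided by that value. The truncated power extends it by 0, so that
    the domain in u does not depend on x, as dominated convergence needs. *)
Definition laplace_integrand (R : realType) (x u : R) : R :=
  powpos (2 * x) (u + Num.sqrt x) * expR (- (u + Num.sqrt x) ^+ 2) /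
  (x `^ x * expR (- x)).

Lemma laplace_integrandE (R : realType) (x u : R) : 0 < x -> 0 < u + Num.sqrt x ->
  laplace_integrand x u =
  expR (2 * x * ln (1 + u / Num.sqrt x) - 2 * u * Num.sqrt x - u ^+ 2).
Proof.
move=> x0 u0; have s0 : 0 < Num.sqrt x by rewrite sqrtr_gt0.
have v0 : 0 < 1 + u / Num.sqrt x.
  have -> : 1 + u / Num.sqrt x = (u + Num.sqrt x) / Num.sqrt x by field; lra.
  by rewrite divr_gt0.
have xs : x = Num.sqrt x ^+ 2 by rewrite sqr_sqrtr// ltW.
rewrite /laplace_integrand powpos_gt0E//.
have lnus : ln (u + Num.sqrt x) = ln (Num.sqrt x) + ln (1 + u / Num.sqrt x).
  by rewrite -lnM ?posrE//; congr ln; field; lra.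
have lnx : ln x = 2 * ln (Num.sqrt x) by rewrite {1}xs lnXn// mulr_natl.
rewrite /powR !gt_eqF// lnus lnx -!expRD -expRN -expRD; congr expR.
set s := Num.sqrt x in xs *; move: (ln s) (ln _) => a b.
by rewrite xs; ring.
Qed.

(** From ln (1 + v) <= v at v = u / sqrt x, the first two terms of the exponent in
    [laplace_integrandE] have a sum at most 0. The bound is uniform in x. *)
Lemma laplace_integrand_le (R : realType) (x u : R) : 0 < x ->
  0 <= laplace_integrand x u <= expR (- u ^+ 2).
Proof.
move=> x0; apply/andP; split.
  by rewrite !mulr_ge0 ?powpos_ge0 ?expR_ge0// invr_ge0 mulr_ge0 ?powR_ge0 ?expR_ge0.
have [u0|u0] := ltP 0 (u + Num.sqrt x); last first.
  by rewrite /laplace_integrand /powpos ltNge u0/= !mul0r expR_ge0.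
rewrite laplace_integrandE// ler_expR.
have s0 : 0 < Num.sqrt x by rewrite sqrtr_gt0.
have xs : x = Num.sqrt x ^+ 2 by rewrite sqr_sqrtr// ltW.
have v1 : -1 < u / Num.sqrt x by rewrite ltr_pdivlMr//; lra.
have : 2 * x * ln (1 + u / Num.sqrt x) <= 2 * x * (u / Num.sqrt x).
  by rewrite ler_pM2l ?mulr_gt0//; exact: le_ln1Dx.
rewrite (_ : 2 * x * (u / _) = 2 * u * Num.sqrt x); first by lra.
by rewrite {1}xs; field; lra.
Qed.

(** With v = u / sqrt x, 2 x (v - v^2 / 2) = 2 u sqrt x - u^2, so the exponent is -2 u^2 up to an
    error of at most 2 x (2 |v|^3) = 4 |u|^3 / sqrt x. The condition |v| <= 1/2 of [ln_taylor2]
    holds for large x. *)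
Lemma cvg_laplace_integrand (R : realType) (u : R) :
  laplace_integrand x u @[x --> +oo] --> expR (- (2 * u ^+ 2)).
Proof.
pose g (x : R) := 2 * x * ln (1 + u / Num.sqrt x) - 2 * u * Num.sqrt x - u ^+ 2.
have near_large (A : R) : \forall x \near +oo, A <= x by apply: nbhs_pinfty_ge; rewrite num_real.
have sq_large (A : R) : \forall x \near +oo, A <= Num.sqrt x.
  near=> x; have [A0|A0] := leP A 0; first by rewrite (le_trans A0) ?sqrtr_ge0.
  rewrite -(ger0_norm (ltW A0)) -sqrtr_sqr ler_sqrt; last first.
    apply: (le_trans (sqr_ge0 A)); near: x; exact: near_large.
  by near: x; exact: near_large.
suff : expR (g x) @[x --> +oo] --> expR (- (2 * u ^+ 2)).
  apply: cvg_trans; apply: near_eq_cvg; near=> x.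
  rewrite laplace_integrandE//.
  have : `|u| + 1 <= Num.sqrt x by near: x; exact: sq_large.
  have := ler_norm (- u); rewrite normrN; lra.
apply: continuous_cvg; first exact: continuous_expR.
apply/cvgrPdist_le => e e0; near=> x.
have x0 : 0 < x by [].
have s0 : 0 < Num.sqrt x by rewrite sqrtr_gt0.
have xs : x = Num.sqrt x ^+ 2 by rewrite sqr_sqrtr// ltW.
have us : 2 * `|u| <= Num.sqrt x by near: x; exact: sq_large.
have es : 4 * `|u| ^+ 3 / e <= Num.sqrt x by near: x; exact: sq_large.
have vE : `|u / Num.sqrt x| = `|u| / Num.sqrt x by rewrite normrM normfV (gtr0_norm s0).
have := @ln_taylor2 _ (u / Num.sqrt x).
rewrite vE ler_pdivrMr// => /(_ ltac:(lra)).
set L := ln _ => HL.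
have -> : - (2 * u ^+ 2) - g x =
    - (2 * x * (L - u / Num.sqrt x + (u / Num.sqrt x) ^+ 2 / 2)).
  by rewrite /g -/L; move: (L) => l; set s := Num.sqrt x in xs s0 *; rewrite xs; field; lra.
rewrite normrN normrM ger0_norm ?mulr_ge0 ?(ltW x0)//.
apply: (@le_trans _ _ (2 * x * (2 * (`|u| / Num.sqrt x) ^+ 3))).
  by rewrite ler_pM2l ?mulr_gt0.
have -> : 2 * x * (2 * (`|u| / Num.sqrt x) ^+ 3) = 4 * `|u| ^+ 3 / Num.sqrt x.
  by rewrite {1}xs; field; lra.
by rewrite ler_pdivrMr// (mulrC e) -ler_pdivrMr.
Unshelve. all: by end_near. Qed.

Lemma measurable_laplace_integrand (R : realType) (x : R) :
  measurable_fun [set: R] (laplace_integrand x).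
Proof.
apply: measurable_funM; last exact: measurable_cst.
have ms : measurable_fun [set: R] (fun u : R => u + Num.sqrt x).
  by apply: measurable_funD; [exact: measurable_id|exact: measurable_cst].
apply: measurable_funM; first exact: (measurableT_comp (@measurable_powpos R _) ms).
have m2 : measurable_fun [set: R] (fun u : R => (u + Num.sqrt x) ^+ 2).
  exact: measurable_funX.
exact: (measurableT_comp (@measurable_expRN R) m2).
Qed.

(* Substitute y = sqrt x + u in the Gaussian form of Gamma. *)
Lemma EGamma_laplace (R : realType) (x : R) : 0 < x ->
  (EGamma (x + 1 / 2) = (2 * (x `^ x * expR (- x)))%:E *
    \int[@lebesgue_measure R]_u (laplace_integrand x u)%:E)%E.
Proof.
move=> x0; have c0 : 0 < x `^ x * expR (- x) by rewrite mulr_gt0 ?powR_gt0 ?expR_gt0.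
have le0 (u : R) : 0 <= laplace_integrand x u.
  by have /andP[] := laplace_integrand_le u x0.
rewrite EFinM -muleA -(ge0_integral_lebesgueZl _ (measurable_laplace_integrand x) le0); last first.
  by rewrite lee_fin ltW.
rewrite EGamma_gauss_itv; apply: (f_equal (mule 2%:E)).
pose f (y : R) := powpos (2 * x) y * expR (- y ^+ 2).
have mf : measurable_fun [set: R] f.
  apply: measurable_funM; first exact: measurable_powpos.
  exact: measurable_gauss_fun.
transitivity (\int[@lebesgue_measure R]_y (f y)%:E)%E.
  rewrite [LHS]integral_mkcond; apply: eq_integral => y _.
  rewrite patchE mem_setE in_itv/= andbT /f /powpos.
  by case: ifP => // _; rewrite mul0r.
rewrite -(@ge0_integral_shift _ _ (Num.sqrt x)); first last.
- by move=> y; rewrite lee_fin /f mulr_ge0 ?expR_ge0 ?powpos_ge0.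
- exact/measurable_EFinP.
apply: eq_integral => u _; rewrite -EFinM /laplace_integrand mulrC divfK//.
by rewrite gt_eqF.
Qed.

(** The Laplace form at x = s - 1/2 needs x > 0; its integrand is dominated by e^(-u^2). *)
Lemma EGamma_fin_half (R : realType) (s : R) : 1 / 2 < s -> (EGamma s < +oo)%E.
Proof.
move=> s12; have x0 : 0 < s - 1 / 2 by lra.
have -> : s = s - 1 / 2 + 1 / 2 by lra.
rewrite EGamma_laplace// lte_mul_pinfty ?lee_fin//.
  by rewrite !mulr_ge0 ?powR_ge0 ?expR_ge0.
apply: (@le_lt_trans _ _ (\int[@lebesgue_measure R]_u (expR (- u ^+ 2))%:E)%E).
  apply: ge0_le_integral => //.
  - by move=> u _; rewrite lee_fin; have /andP[] := laplace_integrand_le u x0.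
  - by apply/measurable_EFinP; exact: measurable_laplace_integrand.
  - by apply/measurable_EFinP; exact: measurable_gauss_fun.
  - by move=> u _; rewrite lee_fin; have /andP[] := laplace_integrand_le u x0.
by have := @integralT_gauss R; rewrite /gauss_fun => ->; rewrite ltry.
Qed.

Lemma EGamma_fin (R : realType) (s : R) : 0 < s -> (EGamma s < +oo)%E.
Proof.
move=> s0; rewrite EGammaS// lte_mul_pinfty ?lee_fin ?invr_ge0 ?(ltW s0)//.
by apply: EGamma_fin_half; lra.
Qed.

Lemma EGamma_EFin (R : realType) (s : R) : 0 < s -> EGamma s = (Gamma s)%:E.
Proof.
by move=> s0; rewrite GammaE fineK// ge0_fin_numE ?EGamma_fin// EGamma_ge0.
Qed.

Lemma GammaS (R : realType) (s : R) : 0 < s -> Gamma (s + 1) = s * Gamma s.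
Proof.
move=> s0; have s10 : 0 < s + 1 by lra.
have := EGammaS s0; rewrite !EGamma_EFin// -EFinM => -[->].
by rewrite mulrA mulfV ?mul1r// gt_eqF.
Qed.

Lemma Gamma_half (R : realType) : Gamma (1 / 2 : R) = Num.sqrt pi.
Proof.
have h0 : 0 < 1 / 2 :> R by lra.
have := EGamma_gauss (0 : R); rewrite add0r EGamma_EFin// mulr0.
under eq_integral do rewrite powRr0 mul1r.
by have := @integralT_gauss R; rewrite /gauss_fun => -> [].
Qed.

Lemma Gamma_gt0 (R : realType) (s : R) : 0 < s -> 0 < Gamma s.
Proof.
move=> s0; rewrite -lte_fin -EGamma_EFin//.
(* On [1, 2], e^(-t) >= e^(-2) and t^(s-1) >= 2^(-|s-1|) whatever the sign of s - 1. *)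
pose c : R := expR (- 2) * expR (- (`|s - 1| * ln 2)).
have c0 : 0 < c by rewrite mulr_gt0 ?expR_gt0.
apply: (@lt_le_trans _ _ (\int[@lebesgue_measure R]_(t in `[1%R, 2%R]) c%:E)%E).
  rewrite integral_cst//= lebesgue_measure_itv/= lte_fin ltr1n/= -EFinB -EFinM lte_fin.
  by rewrite mulr_gt0//; lra.
rewrite EGamma_itv.
apply: (@le_trans _ _ (\int[@lebesgue_measure R]_(t in `[1%R, 2%R])
  (expR (- t) * t `^ (s - 1))%:E)%E).
  apply: ge0_le_integral => //=.
  - by move=> t _; rewrite lee_fin ltW.
  - apply/measurable_EFinP/measurable_funTS; apply: measurable_funM.
      exact: measurable_expRN.
    exact: measurable_powR.
  - move=> t; rewrite in_itv/= => /andP[t1 t2]; rewrite lee_fin.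
    have t0 : 0 < t by lra.
    apply: ler_pM; rewrite ?expR_ge0//; first by rewrite ler_expR; lra.
    rewrite /powR gt_eqF// ler_expR.
    have l0 : 0 <= ln t by exact: ln_ge0.
    have l2 : ln t <= ln 2 by rewrite ler_ln ?posrE//; lra.
    rewrite lerNl -mulNr (@le_trans _ _ (`|s - 1| * ln t))//.
      by rewrite ler_wpM2r// -normrN ler_norm.
    by rewrite ler_wpM2l.
apply: ge0_subset_integral => //=.
- apply/measurable_EFinP/measurable_funTS; apply: measurable_funM.
    exact: measurable_expRN.
  exact: measurable_powR.
- by move=> t _; rewrite lee_fin mulr_ge0 ?expR_ge0 ?powR_ge0.
- by move=> t /=; rewrite !in_itv/= andbT => /andP[t1 _]; lra.
Qed.

Lemma stirling (R : realType) :
  Gamma (x + 1 / 2) / (x `^ x * expR (- x)) @[x --> +oo] --> Num.sqrt (2 * pi : R).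
Proof.
pose I (x : R) : \bar R := (\int[@lebesgue_measure R]_u (laplace_integrand x u)%:E)%E.
have half_gauss : (\int[@lebesgue_measure R]_u (expR (- (2 * u ^+ 2)))%:E =
    ((Num.sqrt 2)^-1 * Num.sqrt pi)%:E)%E.
  have s20 : 0 < Num.sqrt (2 : R) by rewrite sqrtr_gt0.
  have mg : measurable_fun [set: R] (fun u : R => (expR (- u ^+ 2))%:E).
    by apply/measurable_EFinP; exact: measurable_gauss_fun.
  have := ge0_integral_scale s20 mg; have := @integralT_gauss R; rewrite /gauss_fun => ->.
  rewrite -EFinM => <-; last by move=> u; rewrite lee_fin expR_ge0.
  by apply: eq_integral => u _; rewrite exprMn sqr_sqrtr.
(* Convergence is tested along sequences tending to +oo. Replacing x by max(1, x) makes the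
   domination hold at every index and changes nothing near +oo. *)
have cI : I (Num.max 1 x) @[x --> +oo] --> ((Num.sqrt 2)^-1 * Num.sqrt pi)%:E.
  apply/cvge_pinftyP => u uoo; rewrite -half_gauss.
  have m0 n : 0 < Num.max 1 (u n) by rewrite lt_max ltr01.
  have [|||||_ _ //] := @dominated_convergence _ _ _ (@lebesgue_measure R) setT measurableT
    (fun n v => (laplace_integrand (Num.max 1 (u n)) v)%:E)
    (fun v => (expR (- (2 * v ^+ 2)))%:E) (fun v => (expR (- v ^+ 2))%:E).
  - by move=> n; apply/measurable_EFinP; exact: measurable_laplace_integrand.
  - have m2 : measurable_fun [set: R] (fun v : R => 2 * v ^+ 2).
      by apply: measurable_funM => //; exact: measurable_funX.
    by apply/measurable_EFinP; exact: (measurableT_comp (@measurable_expRN R) m2).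
  - apply: aeW => v _; apply: cvg_EFin; first exact: nearW.
    apply: (cvg_comp (fun n => Num.max 1 (u n))) (@cvg_laplace_integrand R v).
    apply/cvgryPge => A; have /cvgryPge/(_ A) := uoo; apply: filterS => n.
    by move=> An; rewrite le_max An orbT.
  - by have := @integrableT_gauss R.
  - apply: aeW => v n _; have /andP[l0 l1] := laplace_integrand_le v (m0 n).
    by rewrite /= lee_fin ger0_norm.
have -> : Num.sqrt (2 * pi) = 2 * ((Num.sqrt 2)^-1 * Num.sqrt (pi : R)).
  rewrite sqrtrM// mulrA; congr (_ * _).
  by rewrite -{2}(@sqr_sqrtr _ 2)// expr2 mulfK// gt_eqF// sqrtr_gt0.
have : 2 * fine (I (Num.max 1 x)) @[x --> +oo] --> 2 * ((Num.sqrt 2)^-1 * Num.sqrt (pi : R)).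
  by apply: cvgM; [exact: cvg_cst|exact: fine_cvg].
apply: cvg_trans; apply: near_eq_cvg; near=> x.
have x1 : 1 <= x by near: x; apply: nbhs_pinfty_ge; rewrite num_real.
have x0 : 0 < x by lra.
rewrite (max_idPr x1) GammaE EGamma_laplace// fineM//.
  rewrite /= -/(I x); field.
  by rewrite !lt0r_neq0 ?expR_gt0 ?powR_gt0.
have c0 : 0 < 2 * (x `^ x * expR (- x)) by rewrite !mulr_gt0 ?powR_gt0 ?expR_gt0.
(* I x is finite because a positive multiple of it is a finite Gamma value. *)
have : EGamma (x + 1 / 2) \is a fin_num by rewrite EGamma_EFin//; lra.
rewrite EGamma_laplace// -/(I x); case: (I x) => //.
  by rewrite gt0_muley ?lte_fin.
by rewrite gt0_muleNy ?lte_fin.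
Unshelve. all: by end_near. Qed.

(** * Integration over the ball *)

Lemma EBetaE (R : realType) (b c : R) : - (1 / 2) < b -> 0 < c ->
  EBeta b c = (Gamma (b + 1 / 2) * Gamma c / Gamma (b + c + 1 / 2))%:E.
Proof.
move=> b0 c0; have := EBeta_EGamma b c; rewrite !EGamma_EFin; [|lra..].
rewrite -EFinM.
have g0 : 0 < Gamma (b + c + 1 / 2) by apply: Gamma_gt0; lra.
set G := Gamma (b + c + 1 / 2) in g0 *; set A := Gamma _ * _ => H.
have GV : G * G^-1 = 1 by rewrite mulfV// gt_eqF.
by rewrite EFinM -H -muleA -EFinM GV mule1.
Qed.

Lemma measurable_dirichlet_integrand (R : realType) (d : nat) (b : 'I_d -> R) (c r : R) :
  measurable_fun [set: d.-tuple (measurableTypeR R)]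
    (fun t : d.-tuple (measurableTypeR R) => (\prod_(i < d) `|tnth t i| `^ (2 * b i)) *
       powpos (c - 1) (r - \sum_(i < d) (tnth t i : R) ^+ 2)).
Proof.
apply: measurable_funM.
  apply: measurable_prod => i _.
  exact: (measurableT_comp (@measurable_normpow R (2 * b i)) (measurable_tnth i)).
apply: (measurableT_comp (@measurable_powpos R (c - 1))).
apply: measurable_funB; first exact: measurable_cst.
apply: measurable_sum => i.
by apply: measurable_funX; exact: measurable_tnth.
Qed.

Lemma tnth_cons_pair (R : realType) (d : nat) (y : measurableTypeR R)
    (t : d.-tuple (measurableTypeR R)) :
  (tnth (cons_pair (y, t)) ord0 = y) *
  (forall i, tnth (cons_pair (y, t)) (lift ord0 i) = tnth t i).
Proof.
split; first exact: tnth0.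
by move=> i; rewrite tnthS.
Qed.

(** The induction keeps r general: with the first coordinate y held fixed, the other coordinates see
    the squared radius r - y^2. Their integral is a multiple of the truncated power of r - y^2 with
    exponent c' - 1, so the last integration is again a Beta integral, with c' for c. In dimension 0
    the measure is a Dirac mass at the empty tuple. *)
Lemma integral_dirichlet (R : realType) (d : nat) (b : 'I_d -> R) (c r : R) :
  (forall i, - (1 / 2) < b i) -> 0 < c ->
  (\int[lebesgue_tuple R d]_t
     ((\prod_(i < d) `|tnth t i| `^ (2 * b i)) *
      powpos (c - 1) (r - \sum_(i < d) (tnth t i : R) ^+ 2))%:E =
   ((\prod_(i < d) Gamma (b i + 1 / 2)) * Gamma c /
    Gamma (\sum_(i < d) b i + d%:R / 2 + c) *
    powpos (\sum_(i < d) b i + d%:R / 2 + c - 1) r)%:E)%E.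
Proof.
move=> + c0; elim: d b r => [|d IH] b r b0.
  rewrite /= integral_dirac//; last first.
    by apply/measurable_EFinP; exact: measurable_dirichlet_integrand.
  rewrite diracT mul1e !big_ord0 subr0 mul0r addr0 add0r !mul1r mulfV ?mul1r//.
  by rewrite gt_eqF// Gamma_gt0.
pose b' (i : 'I_d) := b (lift ord0 i).
have b'0 i : - (1 / 2) < b' i by exact: b0.
pose c' := \sum_(i < d) b' i + d%:R / 2 + c.
have c'0 : 0 < c'.
  (* The term d / 2 is distributed as one 1/2 per coordinate, so that each summand b' i + 1/2 is
     nonnegative. *)
  apply: ltr_wpDl => //; rewrite -[d in d%:R]card_ord -sum1_card natr_sum mulr_suml -big_split/=.
  by apply: sumr_ge0 => i _; have := b'0 i; lra.
have sb : \sum_(i < d.+1) b i = b ord0 + \sum_(i < d) b' i by rewrite big_ord_recl.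
pose f (t : d.+1.-tuple (measurableTypeR R)) : \bar R :=
  ((\prod_(i < d.+1) `|tnth t i| `^ (2 * b i)) *
      powpos (c - 1) (r - \sum_(i < d.+1) (tnth t i : R) ^+ 2))%:E.
have mf : measurable_fun setT f.
  by apply/measurable_EFinP; exact: measurable_dirichlet_integrand.
have f0 t : (0 <= f t)%E.
  rewrite lee_fin mulr_ge0 ?powpos_ge0//.
  by apply: prodr_ge0 => i _; exact: powR_ge0.
have mc := @measurable_cons_pair _ (measurableTypeR R) d.
have mfc : measurable_fun setT (f \o (@cons_pair _ (measurableTypeR R) d)).
  exact: measurableT_comp.
have -> : (\int[lebesgue_tuple R d.+1]_t f t =
  \int[lebesgue_measure \x lebesgue_tuple R d]_z (f \o (@cons_pair _ (measurableTypeR R) d)) z)%E.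
  have := @ge0_integral_pushforward _ _ _ _ _ _ mc (lebesgue_measure \x lebesgue_tuple R d)%E
    setT f measurableT mf (fun t _ => f0 t).
  by rewrite preimage_setT.
rewrite fubini_tonelli1//; last by move=> z; exact: f0.
rewrite /fubini_F/=.
pose C := (\prod_(i < d) Gamma (b' i + 1 / 2)) * Gamma c / Gamma c'.
have C0 : 0 <= C.
  rewrite /C !mulr_ge0 ?invr_ge0 ?ltW ?Gamma_gt0//.
  by apply: prodr_gt0 => i _; rewrite Gamma_gt0//; have := b'0 i; lra.
have inner (y : R) : (\int[lebesgue_tuple R d]_t f (cons_pair (y, t)) =
    C%:E * (`|y| `^ (2 * b ord0) * powpos (c' - 1) (r - y ^+ 2))%:E)%E.
  transitivity (\int[lebesgue_tuple R d]_t ((`|y| `^ (2 * b ord0))%:E *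
     ((\prod_(i < d) `|tnth t i| `^ (2 * b' i)) *
      powpos (c - 1) ((r - y ^+ 2) - \sum_(i < d) (tnth t i : R) ^+ 2))%:E)%E)%E.
    apply: eq_integral => t _; rewrite /f !big_ord_recl tnth_cons_pair -EFinM opprD addrA mulrA.
    congr ((_ * _ * powpos _ (_ - _))%:E).
      by apply: eq_bigr => i _; rewrite tnth_cons_pair.
    by apply: eq_bigr => i _; rewrite tnth_cons_pair.
  rewrite ge0_integralZl//; last 2 first.
  - by apply/measurable_EFinP; exact: measurable_dirichlet_integrand.
  - move=> t _; rewrite lee_fin mulr_ge0 ?powpos_ge0//.
    by apply: prodr_ge0 => i _; exact: powR_ge0.
  by rewrite IH// -!EFinM -/c' -/C; congr EFin; ring.
under eq_integral do rewrite inner.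
rewrite (ge0_integral_lebesgueZl _ (measurable_EBeta_integrand _ _ _) (EBeta_integrand_ge0 _ _ _)); last first.
  by rewrite lee_fin.
(* The product telescopes: the Gamma c' in the numerator of this Beta value cancels the one in the
   denominator of C. *)
rewrite EBeta_scale EBetaE// -!EFinM; congr EFin.
rewrite sb big_ord_recl /C -/c'.
have -> : b ord0 + \sum_(i < d) b' i + d.+1%:R / 2 + c = b ord0 + c' + 1 / 2.
  by rewrite /c' -natr1; field.
have -> : b ord0 + c' + 1 / 2 - 1 = b ord0 + c' - 1 / 2 by field.
have g'0 : Gamma c' != 0 by rewrite gt_eqF// Gamma_gt0.
have g0 : Gamma (b ord0 + c' + 1 / 2) != 0.
  by rewrite gt_eqF// Gamma_gt0//; have := b0 ord0; lra.
rewrite /b'; move: g'0 g0.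
move: (Gamma c') (Gamma (b ord0 + c' + 1 / 2)) (powpos _ _) (Gamma (b ord0 + 1 / 2))
  (Gamma c) (\prod_(i < d) _) => G' G q G0 Gc p g'0 g0.
by field; rewrite g'0 g0.
Qed.

(** * Surface element of the hemispheres *)

Lemma diff_coord (R : realType) (m n : nat) (i : 'I_m) (j : 'I_n) (x v : 'M[R]_(m, n)) :
  'd (fun z : 'M[R]_(m, n) => z i j) x v = v i j.
Proof.
have @f : {linear 'M[R]_(m, n) -> R}.
  by exists (fun N : 'M[R]_(_, _) => N i j); do 2![eexists]; do ?[constructor];
     rewrite ?mxE// => ? *; rewrite ?mxE//; move=> ?; rewrite !mxE.
rewrite (_ : (fun z : 'M[R]_(m, n) => z i j) = f)// diff_lin//.
exact: coord_continuous.
Qed.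

Lemma differentiable_rowP (R : realType) (d n : nat) (F : 'rV[R]_d -> 'rV[R]_n) (x : 'rV[R]_d) :
  (forall k, differentiable (fun y => F y 0 k : R) x) -> differentiable F x.
Proof.
move=> dF.
have -> : F = \sum_(k < n) (fun y => F y 0 k *: delta_mx 0 k).
  by apply/funext => y; rewrite fct_sumE [LHS]row_sum_delta.
apply: differentiable_sum => k.
exact: differentiableZl.
Qed.

Lemma jacobianE (R : realType) (d n : nat) (F : 'rV[R]_d -> 'rV[R]_n) (x : 'rV[R]_d) :
  (forall k, differentiable (fun y => F y 0 k : R) x) ->
  forall i k, ('J F x) i k = 'd (fun y => F y 0 k : R) x (delta_mx 0 i).
Proof.
move=> dF i k; have dFx := differentiable_rowP dF.
have -> : (fun y => F y 0 k : R) = (fun z : 'rV[R]_n => z 0 k) \o F by [].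
rewrite diff_comp//; last exact: differentiable_coord.
by rewrite /= diff_coord /jacobian /lin1_mx mxE.
Qed.

(** The matrix determinant lemma: the block matrix M is factored through the Schur complement of
    either diagonal block, and the two determinants are compared. *)
Lemma det_add_rank1 (R : comRingType) (d : nat) (u : 'cV[R]_d) (v : 'rV[R]_d) :
  \det (1%:M + u *m v) = 1 + (v *m u) 0 0.
Proof.
pose M := block_mx (1%:M : 'M[R]_1) (- v) u (1%:M : 'M[R]_d).
have E1 : M = block_mx 1%:M 0 u 1%:M *m block_mx 1%:M (- v) 0 (1%:M + u *m v).
  rewrite mulmx_block !(mul1mx, mul0mx, mulmx0, mulmx1) !addr0.
  by rewrite mulmxN addrCA addNr addr0.
have E2 : M = block_mx (1%:M + v *m u) (- v) 0 1%:M *m block_mx 1%:M 0 u 1%:M.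
  rewrite mulmx_block !(mul1mx, mul0mx, mulmx0, mulmx1) !add0r.
  by rewrite mulNmx addrK.
have := congr1 determinant (etrans (esym E1) E2).
rewrite !det_mulmx !det_lblock !det_ublock !det1 !mulr1 !mul1r => ->.
by rewrite det_mx11 !mxE eqxx.
Qed.

Lemma hemisphere_widen (R : realType) (d : nat) (s : R) (y : 'rV[R]_d) (j : 'I_d) :
  @hemisphere R d.+1 s y 0 (widen_ord (leqnSn d) j) = y 0 j.
Proof.
rewrite mxE; case: insubP => /= [j' _ j'E|]; last by rewrite ltn_ord.
by congr (y 0 _); apply: val_inj.
Qed.

Lemma hemisphere_max (R : realType) (d : nat) (s : R) (y : 'rV[R]_d) :
  @hemisphere R d.+1 s y 0 ord_max = s * Num.sqrt (1 - sqnorm y).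
Proof. by rewrite mxE insubF//= ltnn. Qed.

Lemma is_diff_sqnorm (R : realType) (d : nat) (y v : 'rV[R]_d) :
  differentiable (@sqnorm R d) y /\
  'd (@sqnorm R d) y v = \sum_(i < d) 2 * y 0 i * v 0 i.
Proof.
have sE : @sqnorm R d = \sum_(i < d) ((fun z : 'rV[R]_d => z 0 i : R) ^+ 2).
  by apply/funext => z; rewrite fct_sumE.
have dc i : differentiable (fun z : 'rV[R]_d => z 0 i : R) y.
  exact: differentiable_coord.
have ds : differentiable (@sqnorm R d) y.
  by rewrite sE; apply: differentiable_sum => i; exact: differentiableX.
split=> //; rewrite -deriveE// sE.
have H i : is_derive y v ((fun z : 'rV[R]_d => z 0 i : R) ^+ 2) (2 * y 0 i * v 0 i).
  have dci : is_derive y v (fun z : 'rV[R]_d => z 0 i : R) (v 0 i).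
    by split; [exact: diff_derivable|rewrite deriveE// diff_coord].
  by apply: is_derive_eq; rewrite /GRing.scale/= expr1 mulr_natl.
by have [] := is_derive_sum H.
Qed.

Lemma is_diff_height (R : realType) (d : nat) (s : R) (y v : 'rV[R]_d) : sqnorm y < 1 ->
  differentiable (fun z : 'rV[R]_d => s * Num.sqrt (1 - sqnorm z)) y /\
  'd (fun z : 'rV[R]_d => s * Num.sqrt (1 - sqnorm z)) y v =
    - (s / Num.sqrt (1 - sqnorm y)) * \sum_(i < d) y 0 i * v 0 i.
Proof.
move=> y1; have w0 : 0 < 1 - sqnorm y by rewrite subr_gt0.
have [ds dsE] := is_diff_sqnorm y v.
have d1 : differentiable (fun z : 'rV[R]_d => 1 - sqnorm z) y by exact: differentiableB.
have [drt drtE] := is_derive1_sqrt w0.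
have dsqrt : differentiable (@Num.sqrt R) (1 - sqnorm y) by exact/derivable1_diffP.
have dcomp : differentiable (@Num.sqrt R \o (fun z : 'rV[R]_d => 1 - sqnorm z)) y.
  exact: differentiable_comp.
split; first exact: differentiableZ.
rewrite (@diffZ _ _ _ (@Num.sqrt R \o (fun z : 'rV[R]_d => 1 - sqnorm z)))// /=.
rewrite diff_comp//= diff1E// derive1E drtE.
rewrite (@diffB R _ R (cst (1 : R)))// diff_cst/= sub0r dsE /GRing.scale/=.
under eq_bigr do rewrite -mulrA; rewrite -mulr_sumr.
by field; rewrite gt_eqF// sqrtr_gt0.
Qed.

(** The Jacobian is the identity next to the gradient column g of the height, so the Gram matrix is
    1 + g g^T. Its determinant is 1 + |g|^2 = 1 + |y|^2 / (1 - |y|^2) = 1 / (1 - |y|^2); the sign s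
    enters only through s^2. *)
Lemma area_element_hemisphere (R : realType) (d : nat) (s : R) (y : 'rV[R]_d) :
  s ^+ 2 = 1 -> sqnorm y < 1 ->
  area_element (@hemisphere R d.+1 s) y = (Num.sqrt (1 - sqnorm y))^-1.
Proof.
move=> s1 y1; have w0 : 0 < 1 - sqnorm y by rewrite subr_gt0.
have sw0 : Num.sqrt (1 - sqnorm y) != 0 by rewrite gt_eqF// sqrtr_gt0.
have coordE k : (exists j, k = widen_ord (leqnSn d) j) \/ k = ord_max.
  have [kd|kd] := ltnP k d.
    by left; exists (Ordinal kd); apply: val_inj.
  by right; apply: val_inj => /=; apply/eqP; rewrite eqn_leq kd -ltnS ltn_ord.
have widenE j : (fun z => @hemisphere R d.+1 s z 0 (widen_ord (leqnSn d) j)) =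
    (fun z : 'rV[R]_d => z 0 j).
  by apply/funext => z; exact: hemisphere_widen.
have maxE : (fun z => @hemisphere R d.+1 s z 0 ord_max) =
    (fun z : 'rV[R]_d => s * Num.sqrt (1 - sqnorm z)).
  by apply/funext => z; exact: hemisphere_max.
have dH k : differentiable (fun z => @hemisphere R d.+1 s z 0 k : R) y.
  have [[j ->]|->] := coordE k.
    by rewrite widenE; exact: differentiable_coord.
  by rewrite maxE; have [] := is_diff_height s 0 y1.
pose g : 'cV[R]_d := \col_i (- (s / Num.sqrt (1 - sqnorm y)) * y 0 i).
rewrite /area_element.
move: (jacobianE dH); move: ('J _ _) => J JE.
have -> : J *m J^T = 1%:M + g *m g^T.
  apply/matrixP => i j; rewrite !mxE big_ord_recr/= !mxE big_ord1 !mxE.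
  rewrite !JE maxE; congr (_ + _ * _).
  - rewrite (bigD1 i)//= big1 ?addr0 => [|k ki].
      by rewrite !mxE !JE widenE !diff_coord !mxE !eqxx mul1r eq_sym.
    by rewrite !mxE !JE widenE !diff_coord !mxE eqxx (negbTE ki) mul0r.
  - have [_ ->] := is_diff_height s (delta_mx 0 i) y1.
    rewrite (bigD1 i)//= big1 ?addr0 => [|k ki].
      by rewrite !mxE !eqxx mulr1.
    by rewrite mxE eqxx (negbTE ki) mulr0.
  - have [_ ->] := is_diff_height s (delta_mx 0 j) y1.
    rewrite (bigD1 j)//= big1 ?addr0 => [|k ki].
      by rewrite !mxE !eqxx mulr1.
    by rewrite mxE eqxx (negbTE ki) mulr0.
rewrite det_add_rank1 -sqrtrV ?ltW//; congr Num.sqrt.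
rewrite mxE; under eq_bigr do rewrite !mxE.
have -> : \sum_(i < d) - (s / Num.sqrt (1 - sqnorm y)) * y 0 i *
    (- (s / Num.sqrt (1 - sqnorm y)) * y 0 i) = (1 - sqnorm y)^-1 * sqnorm y.
  rewrite /sqnorm mulr_sumr; apply: eq_bigr => i _.
  rewrite -/(sqnorm y); have w2 := @sqr_sqrtr _ (1 - sqnorm y) (ltW w0).
  rewrite -{3}w2; move: (Num.sqrt _) sw0 (y 0 i) => r r0 yi.
  rewrite mulrACA !mulrNN -expr2 expr_div_n s1.
  by rewrite mul1r expr2.
by field; rewrite gt_eqF.
Qed.

(** With w = 1 - |y|^2, the last coordinate contributes w^(b_n) and the area element w^(-1/2). The
    exponent is written as c - 1 with c = b_n + 1/2 to fit [integral_dirichlet], and the truncation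
    restricts the integral to the ball. *)
Lemma surface_integral_monomial (R : realType) (d : nat) (s : R) (b : 'I_d.+1 -> R) :
  s ^+ 2 = 1 ->
  (surface_integral (@hemisphere R d.+1 s) (@open_unit_ball R d)
     (fun x => (even_monomial b x)%:E) =
   \int[lebesgue_tuple R d]_t
     ((\prod_(i < d) `|tnth t i| `^ (2 * b (widen_ord (leqnSn d) i))) *
      powpos (b ord_max + 1 / 2 - 1) (1 - \sum_(i < d) (tnth t i : R) ^+ 2))%:E)%E.
Proof.
move=> s1; rewrite /surface_integral [LHS]integral_mkcond.
apply: eq_integral => t _; rewrite patchE.
have sqE : sqnorm (\row_i tnth t i : 'rV[R]_d) = \sum_(i < d) (tnth t i : R) ^+ 2.
  by apply: eq_bigr => i _; rewrite mxE.
case: ifPn => [|/negP]; rewrite inE/= /open_unit_ball/= sqE => y1; last first.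
  by rewrite /powpos subr_gt0; move/negP/negbTE: y1 => ->; rewrite mulr0.
rewrite area_element_hemisphere//; last by rewrite sqE.
rewrite -EFinM; congr EFin; rewrite /even_monomial big_ord_recr/= hemisphere_max sqE.
under eq_bigr do rewrite hemisphere_widen mxE.
have w0 : 0 < 1 - \sum_(i < d) (tnth t i : R) ^+ 2 by rewrite subr_gt0.
rewrite -mulrA; congr (_ * _).
move: (1 - _) w0 => w w0; rewrite powpos_gt0E//.
have ns : `|s| = 1 by rewrite -sqrtr_sqr s1 sqrtr1.
rewrite normrM ns (mul1r `|_|) ger0_norm ?sqrtr_ge0// powRrM powR_mulrn ?sqrtr_ge0// sqr_sqrtr ?ltW//.
rewrite -powR12_sqrt ?ltW// -powRN -powRD; last by rewrite (gt_eqF w0) implybT.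
by congr (_ `^ _); field.
Qed.

Lemma monomial_integralE (R : realType) (d : nat) (b : 'I_d.+1 -> R) :
  (forall k, - (1 / 2) < b k) ->
  monomial_integral b =
    (2 / Gamma (mabs b + d.+1%:R / 2) * \prod_(k < d.+1) Gamma (b k + 1 / 2))%:E.
Proof.
move=> b0; rewrite /monomial_integral /sphere_integral.
rewrite !surface_integral_monomial ?expr1n ?sqrrN ?expr1n//.
have c0 : 0 < b ord_max + 1 / 2 by have := b0 ord_max; lra.
rewrite integral_dirichlet// -EFinD; congr EFin.
rewrite (powpos_gt0E _ ltr01) powR1 mulr1.
rewrite /mabs !big_ord_recr/=.
set S := \sum_(i < d) _; set P := \prod_(i < d) _.
(* The parameter c = b_n + 1/2 supplies both the missing Gamma factor and the missing 1/2 of n /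
   2. *)
have -> : S + d%:R / 2 + (b ord_max + 1 / 2) = S + b ord_max + d.+1%:R / 2.
  by rewrite -natr1; field.
by move: (Gamma _) (Gamma _) => G1 G2; ring.
Qed.

(** * Integer exponents *)

Lemma Gamma_natD (R : realType) (x : R) (N : nat) : 0 < x ->
  Gamma (x + N%:R) = Gamma x * \prod_(0 <= j < N) (x + j%:R).
Proof.
move=> x0; elim: N => [|N IH]; first by rewrite big_nil mulr1 addr0.
rewrite -natr1 addrA GammaS; last by rewrite ltr_wpDr.
by rewrite IH big_nat_recr//=; ring.
Qed.

(** At a = 0 truncated subtraction turns 2a - 1 into 0, and [double_fact 0] = 1 stands for
    (-1)!!. *)
Lemma double_fact_odd (a : nat) :
  double_fact (2 * a.+1 - 1) = ((2 * a + 1) * double_fact (2 * a - 1))%N.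
Proof.
case: a => [//|a].
have x0 : (0 < 2 * a.+1)%N by [].
by rewrite [in LHS]mulnS; case: (2 * a.+1)%N x0 => // x _; rewrite add2n !subn1 addn1.
Qed.

Lemma Gamma_half_nat (R : realType) (a : nat) :
  Gamma (a%:R + 1 / 2 : R) = (double_fact (2 * a - 1))%:R / 2 ^+ a * Num.sqrt pi.
Proof.
elim: a => [|a IH]; first by rewrite add0r Gamma_half expr0 divr1 mul1r.
rewrite -natr1 addrAC GammaS; last by have := ler0n R a; lra.
rewrite IH double_fact_odd natrM natrD natrM exprS.
field.
by rewrite expf_neq0 ?pnatr_eq0.
Qed.

Lemma monomial_integral_nat (R : realType) (d : nat) (alpha : 'I_d.+1 -> nat) :
  (((omega R d.+1)^-1)%:E * monomial_integral (fun k => (alpha k)%:R))%E =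
  (\prod_(k < d.+1 | alpha k != 0%N) (double_fact (2 * alpha k - 1))%:R /
   \prod_(0 <= j < \sum_(k < d.+1) alpha k) (d.+1%:R + 2 * j%:R))%:E :> \bar R.
Proof.
have n0 : 0 < d.+1%:R / 2 :> R by rewrite divr_gt0.
rewrite monomial_integralE; last by move=> k; have := ler0n R (alpha k); lra.
rewrite -EFinM; congr EFin.
rewrite /mabs -natr_sum; set N := (\sum_(k < d.+1) alpha k)%N.
rewrite addrC Gamma_natD// /omega.
under [X in _ * (_ * X)]eq_bigr do rewrite Gamma_half_nat.
rewrite !big_split/= prodr_const card_ord prodfV -expr_sum -/N.
have -> : Num.sqrt pi ^+ d.+1 = pi `^ (d.+1%:R / 2) :> R.
  by rewrite -powR12_sqrt ?pi_ge0// -powR_mulrn ?powR_ge0// -powRrM mulrC.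
(* Each n/2 + j is (n + 2j) / 2; the resulting 2^N cancels the powers of 2 in the half-integer Gamma
   values. *)
have -> : \prod_(0 <= j < N) (d.+1%:R / 2 + j%:R) =
    (\prod_(0 <= j < N) (d.+1%:R + 2 * j%:R)) / 2 ^+ N :> R.
  have <- : \prod_(0 <= j < N) (2 : R) = 2 ^+ N by rewrite prodr_const_nat subn0.
  by rewrite -prodf_div; apply: eq_bigr => j _; field.
(* A zero exponent contributes [double_fact 0] = 1, so the product may run over all k. *)
have -> : \prod_(k < d.+1 | alpha k != 0%N) (double_fact (2 * alpha k - 1))%:R =
    \prod_(k < d.+1) (double_fact (2 * alpha k - 1))%:R :> R.
  by rewrite big_mkcond; apply: eq_bigr => k _; case: (alpha k).
have G0 := Gamma_gt0 n0.
have D0 : 0 < \prod_(0 <= j < N) (d.+1%:R + 2 * j%:R) :> R.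
  by apply: prodr_gt0 => j _; rewrite ltr_wpDr// mulr_ge0.
have p0 : 0 < pi `^ (d.+1%:R / 2) :> R by rewrite powR_gt0// pi_gt0.
have t0 : 0 < 2 ^+ N :> R by rewrite exprn_gt0.
move: (Gamma _) (\prod_(0 <= j < N) _) (pi `^ _) (2 ^+ N) (\prod_(k < d.+1) _) G0 D0 p0 t0.
move=> G D p t A G0 D0 p0 t0.
by field; rewrite !gt_eqF.
Qed.

(** * Asymptotics *)

(** The quotient is (1 + h/x)^(x+h). Its logarithm is at most h + h^2 / x by ln (1 + v) <= v, and at
    least h by the same inequality applied to the reciprocal 1 - h / (x + h). *)
Lemma cvg_powR_shift (R : realType) (h : R) : 0 <= h ->
  (x + h) `^ (x + h) / x `^ (x + h) @[x --> +oo] --> expR h.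
Proof.
move=> h0.
suff : expR ((x + h) * ln (1 + h / x)) @[x --> +oo] --> expR h.
  apply: cvg_trans; apply: near_eq_cvg; near=> x.
  have x0 : 0 < x by [].
  have xh0 : 0 < x + h by rewrite ltr_wpDr.
  rewrite /powR !gt_eqF// -expRN -expRD; congr expR.
  rewrite -mulrBr -ln_div ?posrE//; congr (_ * ln _).
  by rewrite mulrDl mulfV// gt_eqF.
apply: continuous_cvg; first exact: continuous_expR.
apply: (@squeeze_cvgr _ _ _ _ (fun=> h) (fun x => h + h ^+ 2 * x^-1)).
- near=> x; have x0 : 0 < x by [].
  have v0 : 0 <= h / x by rewrite divr_ge0// ltW.
  have xh0 : 0 < x + h by rewrite ltr_wpDr.
  apply/andP; split; last first.
    have -> : h + h ^+ 2 * x^-1 = (x + h) * (h / x) by field; rewrite gt_eqF.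
    by rewrite ler_pM2l// le_ln1Dx//; apply: lt_le_trans v0; rewrite ltrN10.
  have vx : h / (x + h) < 1 by rewrite ltr_pdivrMr// mul1r ltrDr.
  have -> : ln (1 + h / x) = - ln (1 + - (h / (x + h))).
    rewrite -lnV ?posrE; last by rewrite subr_gt0.
    by congr ln; field; rewrite !gt_eqF// addrK.
  rewrite mulrN lerNr.
  have -> : - h = (x + h) * (- (h / (x + h))) by field; rewrite gt_eqF.
  by rewrite ler_pM2l// le_ln1Dx// ltrN2.
- exact: cvg_cst.
- rewrite -[X in _ --> X]addr0; apply: cvgD; first exact: cvg_cst.
  rewrite -[X in _ --> X](mulr0 (h ^+ 2)); apply: cvgM; first exact: cvg_cst.
  by apply/gtr0_cvgV0 => //; exact: nbhs_pinfty_gt.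
Unshelve. all: by end_near. Qed.

(** Passing from (x+h)^(x+h) to x^(x+h) produces e^h, which the e^(-h) in e^(-(x+h)) absorbs. *)
Lemma stirling_shift (R : realType) (h : R) : 0 <= h ->
  Gamma (x + h + 1 / 2) / (x `^ (x + h) * expR (- x)) @[x --> +oo] -->
  Num.sqrt (2 * pi : R).
Proof.
move=> h0.
have H1 : Gamma ((x + h) + 1 / 2) / ((x + h) `^ (x + h) * expR (- (x + h))) @[x --> +oo]
    --> Num.sqrt (2 * pi : R).
  apply: (@cvg_comp _ _ _ (fun x : R => x + h)
    (fun y : R => Gamma (y + 1 / 2) / (y `^ y * expR (- y)))) (@stirling R).
  apply/cvgryPge => A; near=> x.
  by rewrite -lerBlDr; near: x; apply: nbhs_pinfty_ge; rewrite num_real.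
have H2 : (fun _ : R => expR (- h)) x @[x --> +oo] --> expR (- h) by exact: cvg_cst.
have H3 := cvgM (cvgM H1 (cvg_powR_shift h0)) H2.
have -> : Num.sqrt (2 * pi) = Num.sqrt (2 * pi) * expR h * expR (- h) :> R.
  by rewrite -mulrA -expRD subrr expR0 mulr1.
apply: cvg_trans (H3 _ _); apply: near_eq_cvg; near=> x.
have x0 : 0 < x by [].
have xh0 : 0 < x + h by rewrite ltr_wpDr.
have p1 : (x + h) `^ (x + h) != 0 by rewrite gt_eqF// powR_gt0.
have p2 : x `^ (x + h) != 0 by rewrite gt_eqF// powR_gt0.
rewrite /= opprD expRD.
have e1 := expR_gt0 (- x); have e2 := expR_gt0 (- h).
by field; rewrite p1 p2 !gt_eqF.
Unshelve. all: by end_near. Qed.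

Lemma first_to_infty_filter (R : realType) (n m : nat) (c : 'I_n -> R) :
  Filter (first_to_infty m c).
Proof.
apply: filter_from_filter; first by exists 0.
move=> A B _ _; exists (Num.max A B) => // b [bM bc]; split; split=> // k /bM.
  by rewrite gt_max => /andP[].
by rewrite gt_max => /andP[].
Qed.

Lemma cvg_first_coord (R : realType) (n m : nat) (c : 'I_n -> R) (k : 'I_n) : (k < m)%N ->
  (b k @[b --> first_to_infty m c] --> +oo).
Proof.
have ? := @first_to_infty_filter R n m c.
by move=> km; apply/cvgryPge => A; exists A => // b [bA _]; rewrite ltW// bA.
Qed.

Lemma cvg_first_mabs (R : realType) (n m : nat) (c : 'I_n -> R) : (0 < m <= n)%N ->
  mabs b @[b --> first_to_infty m c] --> +oo.
Proof.
have ? := @first_to_infty_filter R n m c.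
move=> /andP[m0 mn]; apply/cvgryPge => A.
pose C := \sum_(k < n | ~~ (k < m)%N) c k.
(* The fixed coordinates sum to C and the others are positive, so a single coordinate above A - C
   suffices. *)
exists (Num.max 0 (A - C)) => // b [bA bc] /=.
have b0 (k : 'I_n) : (k < m)%N -> 0 < b k by move=> /bA; rewrite gt_max => /andP[].
rewrite /mabs (bigID (fun k : 'I_n => (k < m)%N))/=.
rewrite [X in _ + X](eq_bigr c) => [|k]; last by rewrite -leqNgt => /bc.
rewrite -lerBlDr -/C (bigD1 (Ordinal (leq_trans m0 mn)))//= ler_wpDr//.
  by apply: sumr_ge0 => k /andP[/b0 /ltW].
have := bA (Ordinal (leq_trans m0 mn)) m0.
by rewrite gt_max => /andP[_ /ltW].
Qed.

(** Eventually the ratio equals the product of the S (b k), k < m, divided by T (|b|) and by (2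
    pi)^((m-1)/2), with limit sq^m / sq / (2 pi)^((m-1)/2) = 1. The Gamma factors of the fixed
    coordinates cancel. The exponentials of S and T cancel except for the sum over fixed
    coordinates, the source of that exponential in the equivalent. *)
Lemma asymp_first_to_infty (R : realType) (d m : nat) (c : 'I_d.+1 -> R) :
  (1 <= m <= d.+1)%N -> (forall k : 'I_d.+1, (m <= k)%N -> - (1 / 2) < c k) ->
  asymp (first_to_infty m c)
    (fun beta => fine (monomial_integral beta))
    (fun beta =>
       2 * (2 * pi) `^ ((m%:R - 1) / 2) *
       expR (\sum_(k < d.+1 | (m <= k)%N) beta k) *
       \prod_(k < d.+1 | (m <= k)%N) Gamma (beta k + 1 / 2) *
       ((\prod_(k < d.+1 | (k < m)%N) beta k `^ beta k) /
        mabs beta `^ (mabs beta + (d.+1%:R - 1) / 2))).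
Proof.
move=> mn c0; rewrite /asymp; have FF := @first_to_infty_filter R d.+1 m c.
have /andP[m0 md] := mn.
have p20 : 0 < 2 * pi :> R by rewrite mulr_gt0// pi_gt0.
pose sq : R := Num.sqrt (2 * pi); have sq0 : 0 < sq by rewrite sqrtr_gt0.
pose S (x : R) := Gamma (x + 1 / 2) / (x `^ x * expR (- x)).
(* As n = d + 1, h = (n - 1) / 2 and |b| + n/2 = |b| + h + 1/2, the form of [stirling_shift]. *)
pose h : R := d%:R / 2.
pose T (x : R) := Gamma (x + h + 1 / 2) / (x `^ (x + h) * expR (- x)).
have h0 : 0 <= h by rewrite divr_ge0.
have cS : \prod_(k < d.+1 | (k < m)%N) S (b k) @[b --> first_to_infty m c] --> sq ^+ m.
  have -> : sq ^+ m = \prod_(k < d.+1 | (k < m)%N) sq.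
    by rewrite -(big_ord_widen _ (fun=> sq) md) prodr_const card_ord.
  elim: (index_enum 'I_d.+1) => [|k s IH].
    by rewrite big_nil; under eq_fun do rewrite big_nil; exact: cvg_cst.
  rewrite big_cons; under eq_fun do rewrite big_cons.
  case: ifP => // km; apply: cvgM => //.
  by apply: (cvg_comp (fun b : 'I_d.+1 -> R => b k) S) (@stirling R); exact: cvg_first_coord.
have cT : T (mabs b) @[b --> first_to_infty m c] --> sq.
  by apply: (cvg_comp (@mabs R d.+1) T) (stirling_shift h0); exact: cvg_first_mabs.
have H : (\prod_(k < d.+1 | (k < m)%N) S (b k)) * (T (mabs b))^-1 *
    ((2 * pi) `^ ((m%:R - 1) / 2))^-1 @[b --> first_to_infty m c] --> (1 : R).
  have E1 : 1 = sq ^+ m * sq^-1 * ((2 * pi) `^ ((m%:R - 1) / 2))^-1.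
    have -> : (2 * pi) `^ ((m%:R - 1) / 2) = sq ^+ m / sq.
      rewrite /sq -powR12_sqrt ?ltW// -powR_mulrn ?powR_ge0// -powRrM -powRN -powRD.
        by congr (_ `^ _); field.
      by rewrite (gt_eqF p20) implybT.
    by rewrite mulfV// mulf_neq0 ?invr_eq0 ?expf_neq0// gt_eqF.
  rewrite [X in _ --> X]E1.
  by apply: cvgM; [apply: cvgM => //; apply: cvgV => //; rewrite gt_eqF|exact: cvg_cst].
apply: cvg_trans H; apply: near_eq_cvg.
have nmabs : \forall b \near first_to_infty m c, 1 <= mabs b.
  by have /cvgryPge/(_ 1) := @cvg_first_mabs R d.+1 m c mn.
have nfar : \forall b \near first_to_infty m c,
    (forall k : 'I_d.+1, (k < m)%N -> 0 < b k) /\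
    (forall k : 'I_d.+1, (m <= k)%N -> b k = c k) by exists 0.
near=> b.
have b1 : 1 <= mabs b by near: b.
have [bpos bc] : (forall k : 'I_d.+1, (k < m)%N -> 0 < b k) /\
    (forall k : 'I_d.+1, (m <= k)%N -> b k = c k) by near: b.
have bhalf k : - (1 / 2) < b k.
  have [km|km] := ltnP k m; last by rewrite bc// c0.
  by have := bpos k km; lra.
rewrite monomial_integralE//=.
have ltNm (k : 'I_d.+1) : (m <= k)%N = ~~ (k < m)%N by rewrite -leqNgt.
rewrite (eq_bigl _ b ltNm) (eq_bigl _ (fun k => Gamma (b k + 1 / 2)) ltNm).
rewrite [X in _ = _ * X / _](bigID (fun k : 'I_d.+1 => (k < m)%N))/=.
have -> : (d.+1%:R - 1) / 2 = h by rewrite /h -natr1 addrK.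
have -> : mabs b + d.+1%:R / 2 = mabs b + h + 1 / 2 by rewrite /h -natr1; field.
rewrite /S /T prodf_div big_split/= -expR_sum sumrN.
have mE : mabs b = \sum_(k < d.+1 | (k < m)%N) b k + \sum_(k < d.+1 | ~~ (k < m)%N) b k.
  by rewrite /mabs (bigID (fun k : 'I_d.+1 => (k < m)%N)).
have eE : expR (- mabs b) = (expR (\sum_(k < d.+1 | (k < m)%N) b k) *
    expR (\sum_(k < d.+1 | ~~ (k < m)%N) b k))^-1 by rewrite mE expRN expRD.
rewrite eE expRN.
have P0 : 0 < \prod_(k < d.+1 | (k < m)%N) b k `^ b k.
  by apply: prodr_gt0 => k km; rewrite powR_gt0// bpos.
have G20 : 0 < \prod_(k < d.+1 | ~~ (k < m)%N) Gamma (b k + 1 / 2).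
  by apply: prodr_gt0 => k _; rewrite Gamma_gt0//; have := bhalf k; lra.
have X0 : 0 < mabs b `^ (mabs b + h) by rewrite powR_gt0//; lra.
have GG0 : 0 < Gamma (mabs b + h + 1 / 2) by rewrite Gamma_gt0//; lra.
have Q0 : 0 < (2 * pi : R) `^ ((m%:R - 1) / 2) by rewrite powR_gt0.
have e10 := expR_gt0 (\sum_(k < d.+1 | (k < m)%N) b k).
have e20 := expR_gt0 (\sum_(k < d.+1 | ~~ (k < m)%N) b k).
move: (expR _) (expR _) (\prod_(k < d.+1 | (k < m)%N) b k `^ b k)
  (\prod_(k < d.+1 | ~~ (k < m)%N) Gamma (b k + 1 / 2)) (mabs b `^ (mabs b + h))
  (Gamma (mabs b + h + 1 / 2)) (_ `^ ((m%:R - 1) / 2))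
  (\prod_(k < d.+1 | (k < m)%N) Gamma (b k + 1 / 2)) P0 G20 X0 GG0 Q0 e10 e20.
move=> e1 e2 P G2 X G Q G1 P0 G20 X0 GG0 Q0 e10 e20.
by field; rewrite !gt_eqF.
Unshelve. all: by end_near. Qed.

Lemma all_to_infty_first (R : realType) (n : nat) (c : 'I_n -> R) :
  @all_to_infty R n = first_to_infty n c.
Proof.
congr filter_from; apply/funext => M; apply/seteqP; split => b /=.
  by move=> bM; split=> // k; rewrite leqNgt ltn_ord.
by move=> [bM _] k; exact: bM.
Qed.

Theorem proposition2p1 (R : realType) (n : nat) (hn : (3 <= n)%N) :
  (forall beta : 'I_n -> R, (forall k, - (1 / 2) < beta k) ->
     monomial_integral beta =
       (2 / Gamma (mabs beta + n%:R / 2) *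
        \prod_(k < n) Gamma (beta k + 1 / 2))%:E) /\
  (forall alpha : 'I_n -> nat,
     (((omega R n)^-1)%:E * monomial_integral (fun k => (alpha k)%:R))%E =
       (\prod_(k < n | alpha k != 0%N) (double_fact (2 * alpha k - 1))%:R /
        \prod_(0 <= j < \sum_(k < n) alpha k) (n%:R + 2 * j%:R))%:E) /\
  (forall m : nat, (1 <= m <= n)%N ->
   forall c : 'I_n -> R, (forall k : 'I_n, (m <= k)%N -> - (1 / 2) < c k) ->
     asymp (first_to_infty m c)
       (fun beta => fine (monomial_integral beta))
       (fun beta =>
          2 * (2 * pi) `^ ((m%:R - 1) / 2) *
          expR (\sum_(k < n | (m <= k)%N) beta k) *
          \prod_(k < n | (m <= k)%N) Gamma (beta k + 1 / 2) *
          ((\prod_(k < n | (k < m)%N) beta k `^ beta k) /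
           mabs beta `^ (mabs beta + (n%:R - 1) / 2)))) /\
  asymp (@all_to_infty R n)
    (fun beta => fine (monomial_integral beta))
    (fun beta =>
       2 * (2 * pi) `^ ((n%:R - 1) / 2) *
       ((\prod_(k < n) beta k `^ beta k) /
        mabs beta `^ (mabs beta + (n%:R - 1) / 2))).
Proof.
case: n hn => [//|d] _; split; first exact: monomial_integralE.
split; first exact: monomial_integral_nat.
split; first by move=> m mn c c0; exact: asymp_first_to_infty.
have nleq (k : 'I_d.+1) : (d.+1 <= k)%N = false by rewrite leqNgt ltn_ord.
(* This is the case m = n, in which the sum and product over fixed coordinates are empty; the zero
   function is an arbitrary choice of c. *)
rewrite (@all_to_infty_first _ _ (fun=> 0)).
have H : forall k : 'I_d.+1, (d.+1 <= k)%N -> - (1 / 2) < (0 : R).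
  by move=> k; rewrite nleq.
have := @asymp_first_to_infty R d d.+1 (fun=> 0) (leqnn _) H.
congr asymp; apply/funext => b; rewrite !(eq_bigl _ _ nleq) !big_pred0_eq expR0 !mulr1.
by under eq_bigl do rewrite ltn_ord.
Qed.
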